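(* Let $Q$ be a directed graph, $\lambda\in\overline{\mathbb{D}}$, $\mu\in\mathbb{T}$, and let $w=e_1e_2\cdots e_n$ be a finite path in $Q$. Then the representation $\pi_{w,\lambda,\mu}:\mathcal{T}^{+}(Q)\to M_n$ factors through $\mathcal{T}^{+}(\mathcal{C}_n)$ via the representation $\tau_\lambda\circ\pi_\mu\circ\iota_w$; that is, $\iota_w:\mathcal{T}^{+}(Q)\to\mathcal{T}^{+}(\mathcal{C}_n)$ and $\tau_\lambda\circ\pi_\mu:\mathcal{T}^{+}(\mathcal{C}_n)\to M_n$ are completely contractive representations and $\pi_{w,\lambda,\mu}=\tau_\lambda\circ\pi_\mu\circ\iota_w$ on $\mathcal{T}^{+}(Q)$.
   Context: A directed graph $Q$ has vertex set $V(Q)$, edge set $E(Q)$, and range and source maps $r,s:E(Q)\to V(Q)$. A finite path is a sequence $e_1e_2\cdots e_n$ of edges with $r(e_i)=s(e_{i-1})$ for $2\le i\le n$; vertices are paths of length $0$. $\mathcal{T}^{+}(Q)$ is the norm closed operator algebra generated by the left regular representation of $Q$: on the Hilbert space with orthonormal basis $\{\xi_u\}$ indexed by all finite paths $u$ (including vertices), $L_e\xi_u=\xi_{eu}$ if $r(u)=s(e)$ and $0$ otherwise, and $P_v\xi_u=\xi_u$ if $r(u)=v$ and $0$ otherwise; $\mathcal{T}^{+}(Q)$ is generated by $\{P_v,L_e\}$. $\mathcal{C}_n$ is the cycle graph with $n$ distinct edges and $n$ vertices. $\mathcal{T}^{+}(\mathcal{C}_n)$ is identified with the subalgebra of $M_n(A(\mathbb{D}))$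 ($A(\mathbb{D})$ the disk algebra) of matrices whose $(i,j)$ entry has the form $z^{k}f_{i,j}(z^n)$ with $f_{i,j}\in A(\mathbb{D})$ and $k\in\{0,\dots,n-1\}$, $k\equiv j-i \pmod n$. Here $e_{i,j}$ (two indices) is the elementary matrix with $1$ in position $(i,j)$; for $1\le i<n$, $Z_i$ has $z$ in position $(i,i+1)$ and zeros elsewhere; $Z_n$ has $z$ in position $(n,1)$ and zeros elsewhere; $Z_0:=Z_n$. The maps are determined on generators as follows. - $\pi_{w,\lambda,\mu}(P_v)=\sum_{s(e_j)=v}e_{j,j}$ and $\pi_{w,\lambda,\mu}(L_e)=\sum_{e_j=e}\lambda e_{j-1,j}$, where $e_{0,1}:=\mu e_{n,1}$. - $\iota_w(P_v)=\sum_{s(e_j)=v}e_{j,j}$ and $\iota_w(L_e)=\sum_{e_j=e}Z_{j-1}$. - $\pi_\mu$ is the automorphism of $\mathcal{T}^{+}(\mathcal{C}_n)$ with $\pi_\mu(e_{i,i})=e_{i,i}$ for all $i$, $\pi_\mu(Z_i)=Z_i$ for $1\le i<n$, and $\pi_\mu(Z_n)=\mu Z_n$. - $\tau_\lambda:\mathcal{T}^{+}(\mathcal{C}_n)\to M_n$ is evaluation of the matrix function at $z=\lambda$. A completely contractive representation is a completely contractive algebra homomorphism. A completely contractive representation $\pi:A\to B$ of operator algebras factors through an operator algebra $C$ if there are completely contractive representations $\iota:A\to C$ and $\tilde\pi:C\to B$ with $\pi=\tilde\pi\circ\iota$.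
   Formalization: The path w has length n ≥ 1, and existence of ι_w and π_{w,λ,μ} is asserted only for closed w (r(e_1)=s(e_n)); for other w, ι_w is not a homomorphism since L_{e_1}=P_{r(e_1)}L_{e_1} is not respected. The factorization is asserted whenever the maps exist. *)

(* Defs.v *)
(* The scalars are R[i], the complex numbers over an arbitrary realType R. *)
From HB Require Import structures.
From mathcomp Require Import all_boot all_order all_algebra.
From mathcomp Require Import ring lra complex.
From mathcomp Require Import all_classical all_reals all_analysis.
Set Implicit Arguments.
Unset Strict Implicit.
Unset Printing Implicit Defensive.
Import Order.TTheory GRing.Theory Num.Theory.
Import numFieldNormedType.Exports.
Local Open Scope classical_set_scope.
Local Open Scope complex_scope.
Local Open Scope ring_scope.

Record digraph := Digraph {
  vert : choiceType;
  edge : choiceType;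
  rng : edge -> vert;
  src : edge -> vert }.

(* The pair ([:: e1; ..; en], v) encodes the path e1 e2 .. en with source v;
   the second component is redundant unless n = 0, where it is the vertex v
   regarded as a path.  Paths compose from right to left, as operators do. *)
Definition pre_rng (Q : digraph) (es : seq (edge Q)) (v : vert Q) : vert Q :=
  if es is e :: _ then rng e else v.

Fixpoint is_path (Q : digraph) (es : seq (edge Q)) (v : vert Q) : bool :=
  if es is e :: es' then (pre_rng es' v == src e) && is_path es' v else true.

Record gpath (Q : digraph) := GPath {
  pval : seq (edge Q) * vert Q;
  pvalP : is_path pval.1 pval.2 }.

HB.instance Definition _ (Q : digraph) := [isSub for @pval Q].
HB.instance Definition _ (Q : digraph) := [Choice of gpath Q by <:].

Definition pedges (Q : digraph) (u : gpath Q) : seq (edge Q) := (pval u).1.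
Definition psrc (Q : digraph) (u : gpath Q) : vert Q := (pval u).2.
Definition prng (Q : digraph) (u : gpath Q) : vert Q :=
  pre_rng (pedges u) (psrc u).
Definition plen (Q : digraph) (u : gpath Q) : nat := size (pedges u).

(* Edges are numbered from 0: [pedge w j] is the edge e_{j+1} of w. *)
Definition pedge (Q : digraph) (w : gpath Q) (j : 'I_(plen w)) : edge Q :=
  tnth (in_tuple (pedges w)) j.

Definition sqmod (R : realType) (z : R[i]) : R :=
  complex.Re z ^+ 2 + complex.Im z ^+ 2.

Lemma sqmod_ge0 (R : realType) (z : R[i]) : 0 <= sqmod z.
Proof. by rewrite addr_ge0 ?sqr_ge0. Qed.

Lemma sqmod0 (R : realType) : sqmod (0 : R[i]) = 0.
Proof. by rewrite /sqmod /= expr0n addr0. Qed.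

Lemma sqmodM (R : realType) (a b : R[i]) : sqmod (a * b) = sqmod a * sqmod b.
Proof. by case: a b => [a1 a2] [b1 b2]; rewrite /sqmod /=; ring. Qed.

Lemma sqmodD_le (R : realType) (a b : R[i]) :
  sqmod (a + b) <= 2 * sqmod a + 2 * sqmod b.
Proof.
case: a b => [a1 a2] [b1 b2]; rewrite /sqmod /= -subr_ge0.
rewrite (_ : _ - _ = (a1 - b1) ^+ 2 + (a2 - b2) ^+ 2); last by ring.
by rewrite addr_ge0 ?sqr_ge0.
Qed.

Definition ell2_pred (R : realType) (I : choiceType) : {pred I -> R[i]} :=
  [pred x : I -> R[i] | (\esum_(i in [set: I]) (sqmod (x i))%:E < +oo)%E].

Lemma esum_lt_scale (R : realType) (I : choiceType) (c : R) (a : I -> R) :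
  0 <= c -> (forall i, 0 <= a i) ->
  (\esum_(i in [set: I]) (a i)%:E < +oo)%E ->
  (\esum_(i in [set: I]) (c * a i)%:E < +oo)%E.
Proof.
move=> c0 a0 afin.
have E0 : (0 <= \esum_(i in [set: I]) (a i)%:E)%E.
  by apply: esum_ge0 => i _; rewrite lee_fin.
apply: (@le_lt_trans _ _ (c%:E * \esum_(i in [set: I]) (a i)%:E)%E); last first.
  by rewrite lte_mul_pinfty ?lee_fin.
apply: ge_ereal_sup => _ [F [Ffin FT] <-].
rewrite (eq_fsbigr (fun i => (c%:E * (a i)%:E)%E)); last by move=> i _; rewrite EFinM.
rewrite -ge0_mule_fsumr; last by move=> i; rewrite lee_fin.
apply: lee_wpmul2l; first by rewrite lee_fin.
by apply: ereal_sup_ubound; exists F.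
Qed.

Lemma ell2_submod_closed (R : realType) (I : choiceType) :
  submod_closed (@ell2_pred R I).
Proof.
split.
  rewrite inE /= esum1 // => i _.
  by rewrite /GRing.zero /= sqmod0.
move=> c x y; rewrite !inE => xfin yfin.
have H (z : I -> R[i]) (d : R) : 0 <= d ->
    (\esum_(i in [set: I]) (sqmod (z i))%:E < +oo)%E ->
    (\esum_(i in [set: I]) (d * sqmod (z i))%:E < +oo)%E.
  by move=> d0; apply: esum_lt_scale => // i; exact: sqmod_ge0.
apply: (@le_lt_trans _ _ (\esum_(i in [set: I])
   ((2 * sqmod c * sqmod (x i))%:E + (2 * sqmod (y i))%:E))%E).
  apply: le_esum => i _; rewrite -EFinD lee_fin.
  rewrite -mulrA -sqmodM; exact: sqmodD_le.
rewrite esumD; first last.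
- by move=> i _; rewrite lee_fin mulr_ge0 ?sqmod_ge0.
- by move=> i _; rewrite lee_fin !mulr_ge0 ?sqmod_ge0.
by rewrite lte_add_pinfty // H // mulr_ge0 ?sqmod_ge0.
Qed.

HB.instance Definition _ (R : realType) (I : choiceType) :=
  GRing.isSubmodClosed.Build R[i] (I -> R[i]) (@ell2_pred R I)
    (@ell2_submod_closed R I).

Record ell2 (R : realType) (I : choiceType) := Ell2 {
  coord :> I -> R[i];
  coordP : coord \in @ell2_pred R I }.

HB.instance Definition _ (R : realType) (I : choiceType) :=
  [isSub for @coord R I].
HB.instance Definition _ (R : realType) (I : choiceType) :=
  [Choice of ell2 R I by <:].
HB.instance Definition _ (R : realType) (I : choiceType) :=
  [SubChoice_isSubLmodule of ell2 R I by <:].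

Definition ell2_norm (R : realType) (I : choiceType) (x : ell2 R I) : R :=
  Num.sqrt (fine (\esum_(i in [set: I]) (sqmod (x i))%:E)%E).

(* For g a partial map that is injective where defined, [pull gI x] is the
   family u |-> x (g u), extended by 0 where g is undefined. *)
Definition pinj (I : choiceType) (g : I -> option I) : Prop :=
  forall u1 u2 v, g u1 = Some v -> g u2 = Some v -> u1 = u2.

Definition pull_fun (R : realType) (I : choiceType) (g : I -> option I)
    (x : I -> R[i]) : I -> R[i] := fun u => if g u is Some v then x v else 0.

Lemma pull_fun_ell2 (R : realType) (I : choiceType) (g : I -> option I) :
  pinj g -> forall x : ell2 R I, pull_fun g x \in @ell2_pred R I.
Proof.
move=> gI x; have := coordP x; rewrite !inE; apply: le_lt_trans.
pose D := [set u | exists v, g u = Some v].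
pose h u := odflt u (g u).
have hI : set_inj D h.
  move=> u1 u2; rewrite !inE => -[v1 E1] [v2 E2].
  by rewrite /h E1 E2 /= => E; apply: (gI _ _ v1) => //; rewrite E2 E.
have h0 (i : I) : (0 <= (sqmod (x i))%:E)%E by rewrite lee_fin sqmod_ge0.
apply: (@le_trans _ _ (\esum_(u in D) (sqmod (x (h u)))%:E)%E).
  rewrite [leRHS]esum_mkcond; apply: le_esum => u _.
  rewrite /pull_fun; case: ifPn => [|uD].
    by rewrite inE => -[v E]; rewrite /h E.
  case E : (g u) => [v|]; last by rewrite sqmod0.
  by case/negP: uD; rewrite inE; exists v.
rewrite -(esum_image D h (fun i => (sqmod (x i))%:E)) //.
rewrite esum_mkcond; apply: le_esum => u _.
by case: ifP.
Qed.

Definition pull (R : realType) (I : choiceType) (g : I -> option I)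
  (gI : pinj g) (x : ell2 R I) : ell2 R I := Ell2 (pull_fun_ell2 gI x).

Lemma xi_ell2 (R : realType) (I : choiceType) (u : I) :
  (fun i => (i == u)%:R) \in @ell2_pred R I.
Proof.
rewrite inE /=.
rewrite (eq_esum (b := fun i => if i \in [set u] then 1%E else 0%E)); last first.
  move=> i _; case: (eqVneq i u) => [->|ne].
    by rewrite mem_set // /sqmod /= expr1n expr0n addr0.
  by rewrite memNset ?sqmod0 // => E; rewrite E eqxx in ne.
by rewrite -esum_mkcond esum_set1 // ltry.
Qed.

Definition xi (R : realType) (I : choiceType) (u : I) : ell2 R I :=
  Ell2 (xi_ell2 R u).

(* [mxopnorm nrm A] is the norm of the matrix of maps A acting on the k-fold
   Hilbert sum of (H, nrm); it is +oo if A is unbounded. *)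
Definition mxopnorm (R : realType) (H : lmodType R[i]) (nrm : H -> R) (k : nat)
    (A : 'M[H -> H]_k) : \bar R :=
  ereal_sup
    [set (Num.sqrt (\sum_(i < k) nrm (\sum_(j < k) A i j (x j)) ^+ 2))%:E
      | x in [set x : 'I_k -> H | \sum_(j < k) nrm (x j) ^+ 2 <= 1]].

Definition opnorm (R : realType) (H : lmodType R[i]) (nrm : H -> R)
  (A : H -> H) : \bar R := mxopnorm nrm (const_mx A : 'M[H -> H]_1).

Definition bounded_ops (R : realType) (H : lmodType R[i]) (nrm : H -> R) :
  set (H -> H) := [set A | linear A /\ (opnorm nrm A < +oo)%E].

Definition is_closed_subalg (R : realType) (H : lmodType R[i]) (nrm : H -> R)
    (S : set (H -> H)) : Prop :=
  [/\ S `<=` bounded_ops nrm,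
      S 0,
      forall (c : R[i]) A B, S A -> S B -> S (c *: A + B),
      forall A B, S A -> S B -> S (A \o B) &
      forall A, bounded_ops nrm A ->
        (forall eps : R, 0 < eps ->
          exists2 B, S B & (opnorm nrm (A - B)%R < eps%:E)%E) -> S A].

(* The data through which an operator algebra enters: a subset [oa_dom] of an
   ambient space, its product, and the norms on matrices over it. *)
Record opalg (R : realType) := OpAlg {
  oa_car : lmodType R[i];
  oa_mul : oa_car -> oa_car -> oa_car;
  oa_dom : set oa_car;
  oa_norm : forall k : nat, 'M[oa_car]_k -> \bar R }.
Arguments oa_dom {R} o _.
Arguments oa_norm {R} o {k} _.

Definition mx_in (R : realType) (A : opalg R) (k : nat) (M : 'M[oa_car A]_k) :
  Prop := forall i j, oa_dom A (M i j).

Definition is_hom (R : realType) (A B : opalg R) (f : oa_car A -> oa_car B) :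
    Prop :=
  [/\ forall a, oa_dom A a -> oa_dom B (f a),
      forall (c : R[i]) a b, oa_dom A a -> oa_dom A b ->
        f (c *: a + b) = c *: f a + f b &
      forall a b, oa_dom A a -> oa_dom A b ->
        f (oa_mul a b) = oa_mul (f a) (f b)].

Definition bounded_hom (R : realType) (A B : opalg R)
    (f : oa_car A -> oa_car B) : Prop :=
  is_hom f /\ exists C : R, forall a, oa_dom A a ->
    (oa_norm B (const_mx (f a) : 'M[oa_car B]_1)
       <= C%:E * oa_norm A (const_mx a : 'M[oa_car A]_1))%E.

Definition cc_rep (R : realType) (A B : opalg R) (f : oa_car A -> oa_car B) :
    Prop :=
  is_hom f /\ forall (k : nat) (M : 'M[oa_car A]_k), mx_in M ->
    (oa_norm B (map_mx f M) <= oa_norm A M)%E.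

(* The automorphisms of operator algebras are the completely isometric ones. *)
Definition oa_automorphism (R : realType) (A : opalg R)
    (f : oa_car A -> oa_car A) : Prop :=
  [/\ is_hom f, set_bij (oa_dom A) (oa_dom A) f &
      forall (k : nat) (M : 'M[oa_car A]_k), mx_in M ->
        oa_norm A (map_mx f M) = oa_norm A M].

Definition factors_via (R : realType) (A C B : opalg R)
    (p : oa_car A -> oa_car B) (iota : oa_car A -> oa_car C)
    (q : oa_car C -> oa_car B) : Prop :=
  [/\ cc_rep p, cc_rep iota, cc_rep q &
      forall a, oa_dom A a -> p a = q (iota a)].

Definition cv_norm (R : realType) (n : nat) (x : 'cV[R[i]]_n) : R :=
  Num.sqrt (\sum_(i < n) sqmod (x i 0)).

Definition Mn_norm (R : realType) (n k : nat) (M : 'M['M[R[i]]_n]_k) : \bar R :=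
  mxopnorm (@cv_norm R n) (map_mx (fun a (x : 'cV_n) => a *m x) M).

Definition Mn (R : realType) (n : nat) : opalg R :=
  @OpAlg R 'M[R[i]]_n mulmx setT (@Mn_norm R n).

Definition Pmap (Q : digraph) (v : vert Q) (u : gpath Q) : option (gpath Q) :=
  if prng u == v then Some u else None.

(* [Lmap e u] is the path u' such that u = e u', if there is one. *)
Definition Lmap (Q : digraph) (e : edge Q) (u : gpath Q) : option (gpath Q) :=
  if pedges u is e' :: es then if e' == e then insub (es, psrc u) else None
  else None.

Lemma Pmap_pinj (Q : digraph) (v : vert Q) : pinj (Pmap v).
Proof. by move=> u1 u2 w; rewrite /Pmap; do 2!case: ifP => // _; congruence. Qed.

Lemma Lmap_val (Q : digraph) (e : edge Q) (u u' : gpath Q) :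
  (Lmap e u == Some u') = (pval u == (e :: pedges u', psrc u')).
Proof.
apply/eqP/eqP; rewrite /Lmap /pedges /psrc.
  case: u => -[[|e' es] v] /= pu //; case: eqP => // -> {e' pu}.
  by case: insubP => // u1 _ E [<-]; rewrite E.
case: u => u pu /=; move=> E; rewrite E /= eqxx -surjective_pairing.
by rewrite valK.
Qed.

Lemma Lmap_pinj (Q : digraph) (e : edge Q) : pinj (Lmap e).
Proof.
move=> u1 u2 w /eqP; rewrite Lmap_val => /eqP E1 /eqP.
by rewrite Lmap_val => /eqP E2; apply: val_inj; rewrite /= E1 E2.
Qed.

Definition Pop (R : realType) (Q : digraph) (v : vert Q) :
  ell2 R (gpath Q) -> ell2 R (gpath Q) := pull (@Pmap_pinj Q v).

Definition Lop (R : realType) (Q : digraph) (e : edge Q) :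
  ell2 R (gpath Q) -> ell2 R (gpath Q) := pull (@Lmap_pinj Q e).

Lemma Pop_xi (R : realType) (Q : digraph) (v : vert Q) (u : gpath Q) :
  Pop v (xi R u) = if prng u == v then xi R u else 0.
Proof.
apply: val_inj; apply/funext => i /=; rewrite /pull_fun /Pmap.
case: (eqVneq i u) => [->|/negbTE ne]; first by case: ifP.
by case: ifP; case: ifP => //=; rewrite ne.
Qed.

Lemma Lop_xi (R : realType) (Q : digraph) (e : edge Q) (u eu : gpath Q) :
  pval eu = (e :: pedges u, psrc u) -> Lop e (xi R u) = xi R eu.
Proof.
move=> E; apply: val_inj; apply/funext => i /=; rewrite /pull_fun.
have -> : (i == eu) = (Lmap e i == Some u) by rewrite Lmap_val -E.
by case: (Lmap e i).
Qed.

Lemma Lop_xi0 (R : realType) (Q : digraph) (e : edge Q) (u : gpath Q) :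
  prng u <> src e -> Lop e (xi R u) = 0.
Proof.
move=> E; apply: val_inj; apply/funext => i /=; rewrite /pull_fun.
case D : (Lmap e i) => [u'|] //=; case: eqP => // uu; case: E.
move/eqP: D; rewrite uu Lmap_val; case: i => i pi /= /eqP ie.
by move: pi; rewrite ie /= => /andP[/eqP].
Qed.

Definition toeplitz_gen (R : realType) (Q : digraph) :
    set (ell2 R (gpath Q) -> ell2 R (gpath Q)) :=
  [set Pop (R := R) v | v in [set: vert Q]]
    `|` [set Lop (R := R) e | e in [set: edge Q]].

Definition toeplitz (R : realType) (Q : digraph) : opalg R :=
  @OpAlg R (ell2 R (gpath Q) -> ell2 R (gpath Q)) (fun A B => A \o B)
    (smallest (is_closed_subalg (@ell2_norm R (gpath Q))) (@toeplitz_gen R Q))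
    (@mxopnorm R (ell2 R (gpath Q)) (@ell2_norm R (gpath Q))).

Record cdisk (R : realType) := CDisk {
  cdval :> R[i];
  cdvalP : `|cdval| <= 1 }.

(* Only the values of f on the closed unit disk matter. *)
Definition disk_algebra (R : realType) (f : R[i]^o -> R[i]^o) : Prop :=
  {within [set z : R[i]^o | `|z| <= 1], continuous f} /\
  forall z : R[i]^o, `|z| < 1 -> derivable f z 1.

Definition cycle_exp (n : nat) (i j : 'I_n) : nat := ((j + n - i) %% n)%N.

Definition cycle_dom (R : realType) (n : nat) : set (cdisk R -> 'M[R[i]]_n) :=
  [set F | forall i j, exists2 f : R[i]^o -> R[i]^o, disk_algebra f &
    forall z : cdisk R,
      F z i j = cdval z ^+ cycle_exp i j * f (cdval z ^+ n)].

Definition cycle_norm (R : realType) (n k : nat)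
    (M : 'M[cdisk R -> 'M[R[i]]_n]_k) : \bar R :=
  ereal_sup [set Mn_norm (map_mx (fun F => F z) M) | z in [set: cdisk R]].

Definition cycle_alg (R : realType) (n : nat) : opalg R :=
  @OpAlg R (cdisk R -> 'M[R[i]]_n) (fun F G z => F z *m G z)
    (@cycle_dom R n) (@cycle_norm R n).

(* [Zgen i] is Z_{i+1}: indices start at 0 and are cyclic ([ordS] and
   [ord_pred]), so that Z_0 = Z_n and, up to the scalar mu, e_{0,1} = e_{n,1}. *)
Definition Zgen (R : realType) (n : nat) (i : 'I_n) : cdisk R -> 'M[R[i]]_n :=
  fun z => cdval z *: delta_mx i (ordS i).

Definition is_pi_w (R : realType) (Q : digraph) (w : gpath Q)
    (lam : cdisk R) (mu : R[i])
    (p : oa_car (toeplitz R Q) -> oa_car (Mn R (plen w))) : Prop :=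
  [/\ bounded_hom p,
      forall v, p (Pop (R := R) v)
        = \sum_(j < plen w | src (pedge j) == v) delta_mx j j &
      forall e, p (Lop (R := R) e)
        = \sum_(j < plen w | pedge j == e)
            (cdval lam * (if j == 0%N :> nat then mu else 1))
              *: delta_mx (ord_pred j) j].

Definition is_iota_w (R : realType) (Q : digraph) (w : gpath Q)
    (f : oa_car (toeplitz R Q) -> oa_car (cycle_alg R (plen w))) : Prop :=
  [/\ bounded_hom f,
      forall v, f (Pop (R := R) v)
        = fun=> \sum_(j < plen w | src (pedge j) == v) delta_mx j j &
      forall e, f (Lop (R := R) e)
        = \sum_(j < plen w | pedge j == e) Zgen (R := R) (ord_pred j)].

Definition is_pi_mu (R : realType) (n : nat) (mu : R[i])
    (f : oa_car (cycle_alg R n) -> oa_car (cycle_alg R n)) : Prop :=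
  [/\ oa_automorphism f,
      forall i : 'I_n, f (fun=> delta_mx i i) = fun=> delta_mx i i &
      forall i : 'I_n, f (Zgen (R := R) i)
        = if i.+1 == n then mu *: Zgen (R := R) i else Zgen (R := R) i].

Definition tau (R : realType) (n : nat) (lam : cdisk R)
  (F : oa_car (cycle_alg R n)) : oa_car (Mn R n) := F lam.

(* Main.v *)
Require Import Defs.
From mathcomp Require Import all_boot all_order all_algebra.
From mathcomp Require Import ring lra zify complex.
From mathcomp Require Import all_classical all_reals all_analysis.
Set Implicit Arguments.
Unset Strict Implicit.
Unset Printing Implicit Defensive.
Import Order.TTheory GRing.Theory Num.Theory.
Import numFieldNormedType.Exports.
Local Open Scope classical_set_scope.
Local Open Scope complex_scope.
Local Open Scope ring_scope.

(** Everything rests on one completely contractive representation [cycle_rep]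
    of the path algebra into the cycle algebra that takes the prescribed values
    on generators.  Two bounded homomorphisms that agree on the generators agree
    on the norm closed algebra they generate ([bounded_hom_unique]); hence every
    iota_w coincides with [cycle_rep], every pi_(w,lambda,mu) coincides with
    tau_lambda o pi_mu o iota_w, and complete contractivity is inherited from
    the composition.  The map pi_mu is F(z) |-> D F(nu z) D^-1 with nu^n = mu
    and D = diag(nu^i), a unitary conjugation at each point ([rotate_pi_mu]).

    An iota_w exists only if w is closed: with e = e_1 the relation
    L_e = P_(r(e)) L_e is respected only if r(e_1) = s(e_n)
    ([iota_w_closed]).  A closed path unrolls to an n-periodic sequence of edges
    E, whose arcs E_(i+1) .. E_(i+d) are written [arc i d].  The elements of the
    path algebra act along arcs by convolution: there are coefficients
    [coef A i c] with
      (A y)(arc i d) = \sum_(c <= d) coef A i c * y (arc (i + c) (d - c)).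
    The (i,j) entry of the image of A is then the power series of the
    [coef A i d] z^d with i + d = j modulo n; for operators with finitely many
    coefficients it is a polynomial ([symbol]), and convolution turns into the
    product of matrices ([symbol_comp]).

    Contractivity comes from compressions.  For z in the closed disk and
    S_N = \sum_(m < N) |z|^(2m), the n vectors
      S_N^(-1/2) \sum_(m < N) conj(z)^m xi_(arc j m) (x) b_(j+m mod n)
    are orthonormal; the second tensor factor is there because arcs with
    different starting indices may coincide, as for w = ee.  The compression of
    A (x) 1 to their span is completely contractive
    ([compression_contractive]), and its (i,j) entry is the symbol with the
    coefficient of z^d damped by S_(N-d) / S_N, a Fejer mean when |z| = 1.
    These factors tend to 1, so symbols are limits of complete contractions at
    every point of the closed disk, boundary included
    ([compression_cvg], [symbol_bound]).

    Passing to norm limits uses two facts.  An entry of a symbol has the form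
    z^k p(z^n) with |p| <= 2 |A| on the disk ([symbol_poly_bound]), so that
    p |-> p(x) is Lipschitz and extends by intersecting disks ([disk_helly]);
    and uniform limits of polynomials with bounded coefficients lie in the disk
    algebra ([limit_disk_algebra]), because their second divided differences are
    bounded inside the disk.  Multiplicativity, the values on generators and
    complete contractivity of [cycle_rep] then follow by density. *)

(** * The complex modulus *)

Section ComplexModulus.
Variable R : realType.
Implicit Types (z : R[i]) (e : R).

Definition cabs z : R := Num.sqrt (sqmod z).

Lemma cabsE z : `|z| = (cabs z)%:C.
Proof. exact: normc_def. Qed.

Lemma cabs_ge0 z : 0 <= cabs z.
Proof. exact: sqrtr_ge0. Qed.

Lemma sqr_cabs z : cabs z ^+ 2 = sqmod z.
Proof. by rewrite sqr_sqrtr ?sqmod_ge0. Qed.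

Lemma cabsM (a b : R[i]) : cabs (a * b) = cabs a * cabs b.
Proof. by rewrite /cabs sqmodM sqrtrM ?sqmod_ge0. Qed.

Lemma cabs0 : cabs 0 = 0.
Proof. by rewrite /cabs sqmod0 sqrtr0. Qed.

Lemma cabs1 : cabs 1 = 1.
Proof. by apply: complexI; rewrite -cabsE normr1. Qed.

Lemma cabsN z : cabs (- z) = cabs z.
Proof. by apply: complexI; rewrite -!cabsE normrN. Qed.

Lemma cabsX z k : cabs (z ^+ k) = cabs z ^+ k.
Proof. by apply: complexI; rewrite rmorphXn /= -!cabsE normrX. Qed.

Lemma cabsV z : cabs z^-1 = (cabs z)^-1.
Proof. by apply: complexI; rewrite fmorphV /= -!cabsE normfV. Qed.

Lemma cabs_eq0 z : cabs z = 0 -> z = 0.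
Proof. by move=> z0; apply/normr0_eq0; rewrite cabsE z0. Qed.

Lemma ler_cabsD (a b : R[i]) : cabs (a + b) <= cabs a + cabs b.
Proof. by rewrite -lecR rmorphD /= -!cabsE ler_normD. Qed.

Lemma ler_cabsB (a b : R[i]) : cabs (a - b) <= cabs a + cabs b.
Proof. by rewrite -(cabsN b) ler_cabsD. Qed.

Lemma cabsB (a b : R[i]) : cabs (a - b) = cabs (b - a).
Proof. by rewrite -cabsN opprB. Qed.

Lemma ler_cabs_sum (I : Type) (s : seq I) (P : pred I) (F : I -> R[i]) :
  cabs (\sum_(i <- s | P i) F i) <= \sum_(i <- s | P i) cabs (F i).
Proof.
elim/big_rec2: _ => [|i y x _ le]; first by rewrite cabs0.
by rewrite (le_trans (ler_cabsD _ _)) // lerD2l.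
Qed.

Lemma cabs_le1 z : (`|z| <= 1) = (cabs z <= 1).
Proof. by rewrite cabsE -[1]/(1%:C) lecR. Qed.

Lemma cabs_lt1 z : (`|z| < 1) = (cabs z < 1).
Proof. by rewrite cabsE -[1]/(1%:C) ltcR. Qed.

Lemma cabs_conj z : cabs z^* = cabs z.
Proof. by apply: complexI; rewrite -!cabsE normcJ. Qed.

Lemma Re_le_cabs z : `|complex.Re z| <= cabs z.
Proof. by rewrite -lecR -cabsE normc_ge_Re. Qed.

Lemma ler_cabs_ReIm z : cabs z <= `|complex.Re z| + `|complex.Im z|.
Proof.
rewrite -(@ler_pXn2r _ 2) ?nnegrE ?cabs_ge0 ?addr_ge0 //.
rewrite sqr_cabs sqrrD !real_normK ?num_real // /sqmod.
by rewrite lerD2r lerDl mulrn_wge0 // mulr_ge0.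
Qed.

Lemma Im_le_cabs z : `|complex.Im z| <= cabs z.
Proof.
rewrite -(@ler_pXn2r _ 2) ?nnegrE ?cabs_ge0 //.
by rewrite sqr_cabs real_normK ?num_real // /sqmod lerDr sqr_ge0.
Qed.

Lemma real_cauchy_schwarz (I : Type) (s : seq I) (P : pred I) (x y : I -> R) :
  (\sum_(i <- s | P i) x i * y i) ^+ 2 <=
  (\sum_(i <- s | P i) x i ^+ 2) * (\sum_(i <- s | P i) y i ^+ 2).
Proof.
set p := \sum_(i <- s | P i) _; set X := \sum_(i <- s | P i) _.
set Y := \sum_(i <- s | P i) _.
have Y0 : 0 <= Y by apply: sumr_ge0 => i _; exact: sqr_ge0.
(* The quadratic form is nonnegative; its discriminant is what is wanted. *)
have key t u : 0 <= t ^+ 2 * X - 2 * t * u * p + u ^+ 2 * Y.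
  have -> : t ^+ 2 * X - 2 * t * u * p + u ^+ 2 * Y =
      \sum_(i <- s | P i) (t * x i - u * y i) ^+ 2.
    rewrite /X /Y /p !mulr_sumr -sumrB -big_split /=.
    by apply: eq_bigr => i _; ring.
  by apply: sumr_ge0 => i _; exact: sqr_ge0.
have [Ypos|] := ltP 0 Y.
  have := key Y p; rewrite (_ : _ - _ + _ = Y * (X * Y - p ^+ 2)); last by ring.
  by rewrite pmulr_rge0 // subr_ge0.
move=> Yle; have YE : Y = 0 by apply/le_anti; rewrite Yle.
have p0 : p = 0.
  apply/eqP; case: (eqVneq p 0) => // p_neq0.
  (* If Y = 0 the form is affine in u, so p must vanish: this u would give
     -1. *)
  have := key 1 ((X + 1) / (2 * p)); rewrite YE mulr0 addr0.
  have -> : 1 ^+ 2 * X - 2 * 1 * ((X + 1) / (2 * p)) * p = -1 by field.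
  by rewrite oppr_ge0 ler10.
by rewrite p0 expr0n YE mulr0.
Qed.

Lemma cauchy_schwarz (I : Type) (s : seq I) (P : pred I) (a b : I -> R[i]) :
  sqmod (\sum_(i <- s | P i) a i * b i) <=
  (\sum_(i <- s | P i) sqmod (a i)) * (\sum_(i <- s | P i) sqmod (b i)).
Proof.
under [X in X * _]eq_bigr do rewrite -sqr_cabs.
under [X in _ * X]eq_bigr do rewrite -sqr_cabs.
apply: le_trans (real_cauchy_schwarz _ _ _ _).
rewrite -sqr_cabs ler_sqr ?nnegrE ?cabs_ge0 //; last first.
  by apply: sumr_ge0 => i _; rewrite mulr_ge0 ?cabs_ge0.
apply: le_trans (ler_cabs_sum _ _ _) _.
by under eq_bigr do rewrite cabsM.
Qed.

(** With a free weight e this replaces the triangle inequality in sums of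
    squares, and becomes sharp as e tends to 0. *)
Lemma sqmodD_wt (a b : R[i]) e : 0 < e ->
  sqmod (a + b) <= (1 + e) * sqmod a + (1 + e^-1) * sqmod b.
Proof.
case: a b => [a1 a2] [b1 b2] e0; rewrite /sqmod /= -subr_ge0.
rewrite (_ : _ - _ = ((e * a1 - b1) ^+ 2 + (e * a2 - b2) ^+ 2) / e).
  by rewrite divr_ge0 ?addr_ge0 ?sqr_ge0 ?ltW.
by field; rewrite gt_eqF.
Qed.

(** Helly's theorem on the line: the supremum of the left ends lies in every
    interval. *)
Lemma interval_helly (T : Type) (B : set T) (a r : T -> R) : B !=set0 ->
  (forall b b', B b -> B b' -> a b - a b' <= r b + r b') ->
  exists w, forall b, B b -> `|w - a b| <= r b.
Proof.
move=> [b0 Bb0] H; pose E := [set a b - r b | b in B].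
have Eub b : B b -> ubound E (a b + r b).
  by move=> Bb _ [b' Bb' <-]; have := H _ _ Bb' Bb; lra.
have Esup : has_sup E.
  by split; [exists (a b0 - r b0); exists b0|exists (a b0 + r b0); exact: Eub].
exists (sup E) => b Bb; rewrite ler_distl; apply/andP; split.
  by apply: sup_upper_bound => //; exists b.
by apply: ge_sup; [case: Esup|exact: Eub].
Qed.

(** A substitute for completeness: a point whose distances to the a_b obey
    prescribed bounds exists as soon as those bounds are pairwise
    compatible. Real and imaginary parts are treated separately, which costs
    the factor 2. *)
Lemma disk_helly (T : Type) (B : set T) (a : T -> R[i]) (r : T -> R) :
  B !=set0 ->
  (forall b b', B b -> B b' -> cabs (a b - a b') <= r b + r b') ->
  exists w, forall b, B b -> cabs (w - a b) <= 2 * r b.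
Proof.
move=> B0 H.
have [|u Hu] := @interval_helly T B (fun b => complex.Re (a b)) r B0.
  move=> b b' Bb Bb'; apply: le_trans (H _ _ Bb Bb').
  by apply: le_trans (Re_le_cabs _); rewrite raddfB ler_norm.
have [|v Hv] := @interval_helly T B (fun b => complex.Im (a b)) r B0.
  move=> b b' Bb Bb'; apply: le_trans (H _ _ Bb Bb').
  by apply: le_trans (Im_le_cabs _); rewrite raddfB ler_norm.
exists (u +i* v) => b Bb; apply: le_trans (ler_cabs_ReIm _) _.
by have := Hu _ Bb; have := Hv _ Bb; rewrite !raddfB /=; lra.
Qed.

Lemma ler_gt0_addeps (x y K : R) : 0 <= K ->
  (forall e, 0 < e -> x <= y + K * e) -> x <= y.
Proof.
move=> K0 H; apply/ler_addgt0Pr => e e0.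
have K1 : 0 < K + 1 by rewrite ltr_wpDl.
apply: le_trans (H (e / (K + 1)) _) _; first by rewrite divr_gt0.
rewrite lerD2l mulrA ler_pdivrMr // mulrC ler_pM2l //; lra.
Qed.

Lemma sqmod_real (r : R) : sqmod r%:C = r ^+ 2.
Proof. by rewrite /sqmod /= expr0n addr0. Qed.

Lemma sqmod_conj z : sqmod z^* = sqmod z.
Proof. by rewrite -!sqr_cabs cabs_conj. Qed.

Lemma sqmodX z (m : nat) : sqmod (z ^+ m) = sqmod z ^+ m.
Proof. by rewrite -!sqr_cabs cabsX -!exprM mulnC. Qed.

Lemma mul_conj z : z * z^* = (sqmod z)%:C.
Proof. by rewrite -sqr_normc cabsE -rmorphXn /= sqr_cabs. Qed.

Lemma complex_eq_small (u v : R[i]) (K : R) : 0 <= K ->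
  (forall e, 0 < e -> e <= 1 -> cabs (u - v) <= K * e) -> u = v.
Proof.
move=> K0 H; apply/eqP; rewrite -subr_eq0; apply/eqP/cabs_eq0/le_anti.
rewrite cabs_ge0 andbT; apply: (ler_gt0_addeps K0) => e e0; rewrite add0r.
have e'0 : 0 < Num.min e 1 by rewrite lt_min e0 /=.
apply: le_trans (H _ e'0 _) _; first by rewrite ge_min lexx orbT.
by apply: ler_wpM2l => //; rewrite ge_min lexx.
Qed.

Lemma cabs_comb_dist (a x u v u' v' : R[i]) (p q r : R) :
  cabs (x - (a * u + v)) <= p -> cabs (u' - u) <= q -> cabs (v' - v) <= r ->
  cabs (x - (a * u' + v')) <= p + (cabs a * q + r).
Proof.
move=> xp uq vr.
have -> : x - (a * u' + v') =
  (x - (a * u + v)) - (a * (u' - u) + (v' - v)) by ring.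
apply: le_trans (ler_cabsB _ _) _; apply: lerD => //.
apply: le_trans (ler_cabsD _ _) _; apply: lerD => //.
by rewrite cabsM; apply: ler_wpM2l => //; exact: cabs_ge0.
Qed.

(** The terms decrease, so the last D of K + D terms carry at most D/K of
    the total: this is why the means S_(N-d)/S_N converge to 1. *)
Lemma geom_tail (r : R) (D K : nat) : 0 <= r -> r <= 1 ->
  K%:R * \sum_(m < D) r ^+ (K + m) <= D%:R * \sum_(m < K + D) r ^+ m.
Proof.
move=> r0 r1; apply: (@le_trans _ _ (K%:R * (D%:R * r ^+ K))).
  apply: ler_wpM2l => //; rewrite mulr_natl -[D in _ *+ D]card_ord -sumr_const.
  by apply: ler_sum => m _; rewrite exprD ler_piMr ?exprn_ge0 // exprn_ile1.
rewrite mulrCA; apply: ler_wpM2l => //.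
rewrite big_split_ord /= -[leLHS]addr0; apply: lerD; last first.
  by apply: sumr_ge0 => m _; exact: exprn_ge0.
rewrite mulr_natl -[K in _ *+ K]card_ord -sumr_const; apply: ler_sum => m _.
by rewrite ler_wiXn2l // ltnW.
Qed.

End ComplexModulus.

(** * Uniform limits of polynomials and the disk algebra *)

Section DiskAlgebra.
Variable R : realType.
Implicit Types (p : {poly R[i]}) (x y z : R[i]) (C r e : R).

Definition coef_bounded (p : {poly R[i]}) (C : R) := forall d, cabs p`_d <= C.

Lemma coef_bounded_Horner p c C :
  coef_bounded (p * 'X + c%:P) C -> coef_bounded p C /\ cabs c <= C.
Proof.
move=> H; split=> [d|].
  by have := H d.+1; rewrite coefD coefMX coefC /= addr0.
by have := H 0%N; rewrite coefD coefMX coefC /= add0r.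
Qed.

(** The three estimates bound p, its first and its second divided
    differences on the disk of radius r by C/(1-r), C/(1-r)^2 and C/(1-r)^3.
    Each is an induction along the scheme p = p1 X + c, which reproduces the
    constant exactly. *)
Lemma horner_bound p C r x : 0 <= C -> r < 1 -> coef_bounded p C ->
  cabs x <= r -> cabs p.[x] <= C / (1 - r).
Proof.
move=> C0 r1 + xr; have r0 : 0 <= r := le_trans (cabs_ge0 _) xr.
have s0 : 0 < 1 - r by rewrite subr_gt0.
elim/poly_ind: p => [|p c IH] H.
  by rewrite horner0 cabs0 divr_ge0 // ltW.
have [/IH {}IH cC] := coef_bounded_Horner H.
rewrite hornerMXaddC; apply: le_trans (ler_cabsD _ _) _; rewrite cabsM.
have -> : C / (1 - r) = C / (1 - r) * r + C by field; rewrite gt_eqF.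
by apply: lerD => //; rewrite ler_pM ?cabs_ge0.
Qed.

Lemma horner_lipschitz p C r x y : 0 <= C -> r < 1 -> coef_bounded p C ->
  cabs x <= r -> cabs y <= r ->
  cabs (p.[x] - p.[y]) <= C / (1 - r) ^+ 2 * cabs (x - y).
Proof.
move=> C0 r1 + xr yr; have r0 : 0 <= r := le_trans (cabs_ge0 _) xr.
have s0 : 0 < 1 - r by rewrite subr_gt0.
elim/poly_ind: p => [|p c IH] H.
  rewrite !horner0 subrr cabs0 mulr_ge0 ?cabs_ge0 // divr_ge0 //.
  by rewrite exprn_ge0 // ltW.
have [pC cC] := coef_bounded_Horner H; rewrite !hornerMXaddC.
rewrite (_ : _ - _ = x * (p.[x] - p.[y]) + p.[y] * (x - y)); last by ring.
apply: le_trans (ler_cabsD _ _) _; rewrite !cabsM.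
rewrite (_ : C / (1 - r) ^+ 2 = r * (C / (1 - r) ^+ 2) + C / (1 - r)).
  rewrite mulrDl; apply: lerD; last first.
    by rewrite ler_wpM2r ?cabs_ge0 // horner_bound.
  by rewrite -mulrA ler_pM ?cabs_ge0 ?IH.
by field; rewrite gt_eqF.
Qed.

Lemma horner_lipschitz_disk p : exists2 K, 0 <= K & forall x y,
  cabs x <= 1 -> cabs y <= 1 -> cabs (p.[x] - p.[y]) <= K * cabs (x - y).
Proof.
suff [K K0 HK] : exists2 K, 0 <= K & forall x y, cabs x <= 1 -> cabs y <= 1 ->
    cabs p.[x] <= K /\ cabs (p.[x] - p.[y]) <= K * cabs (x - y).
  by exists K => // x y x1 y1; case: (HK _ _ x1 y1).
elim/poly_ind: p => [|p c [K K0 IH]].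
  by exists 0 => // x y _ _; rewrite !horner0 subrr cabs0 mul0r.
exists (K + K + cabs c); first by rewrite !addr_ge0 ?cabs_ge0.
move=> x y x1 y1; have [px pxy] := IH _ _ x1 y1; have [py _] := IH _ _ y1 y1.
rewrite !hornerMXaddC; split.
  apply: le_trans (ler_cabsD _ _) _; rewrite lerD2r cabsM.
  by apply: (@le_trans _ _ (cabs p.[x])); [rewrite ler_piMr ?cabs_ge0|lra].
rewrite (_ : _ - _ = x * (p.[x] - p.[y]) + p.[y] * (x - y)); last by ring.
apply: le_trans (ler_cabsD _ _) _; rewrite !cabsM !mulrDl.
rewrite -[X in X <= _]addr0; apply: lerD; last by rewrite mulr_ge0 ?cabs_ge0.
apply: lerD; last by rewrite ler_wpM2r ?cabs_ge0.
by apply: le_trans pxy; rewrite ler_piMl ?cabs_ge0.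
Qed.

(** Stated without quotients, so that it passes to pointwise limits. *)
Lemma horner_second_difference p C r x y z :
  0 <= C -> r < 1 -> coef_bounded p C ->
  cabs x <= r -> cabs y <= r -> cabs z <= r ->
  cabs ((p.[x] - p.[z]) * (y - z) - (p.[y] - p.[z]) * (x - z))
    <= C / (1 - r) ^+ 3 * (cabs (x - y) * cabs (x - z) * cabs (y - z)).
Proof.
move=> C0 r1 + xr yr zr; have r0 : 0 <= r := le_trans (cabs_ge0 _) xr.
have s0 : 0 < 1 - r by rewrite subr_gt0.
elim/poly_ind: p => [|p c IH] H.
  rewrite !horner0 !(subrr, mul0r, cabs0) !mulr_ge0 ?cabs_ge0 // invr_ge0.
  by rewrite exprn_ge0 // ltW.
have [pC cC] := coef_bounded_Horner H; rewrite !hornerMXaddC.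
(* Recursion of divided differences: p[x,y,z] = x p1[x,y,z] + p1[y,z]. *)
rewrite (_ : _ - _ = x * ((p.[x] - p.[z]) * (y - z) - (p.[y] - p.[z]) * (x - z))
  + (p.[y] - p.[z]) * ((x - y) * (x - z))); last by ring.
apply: le_trans (ler_cabsD _ _) _.
set D := _ - _ * (x - z); rewrite (cabsM x) (cabsM _ (_ * _)) (cabsM (x - y)).
set t := cabs (x - y) * _.
have t0 : 0 <= t by rewrite mulr_ge0 ?cabs_ge0.
rewrite (_ : C / (1 - r) ^+ 3 = r * (C / (1 - r) ^+ 3) + C / (1 - r) ^+ 2).
  rewrite mulrDl; apply: lerD; last first.
    rewrite [t * _]mulrC [leRHS]mulrA ler_wpM2r //.
    exact: horner_lipschitz.
  rewrite -mulrA ler_pM ?cabs_ge0 //.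
  exact: IH.
by field; rewrite gt_eqF.
Qed.

(** The common bound C on the coefficients is what bounds the divided
    differences of all the polynomials at once. *)
Definition unif_poly_limit (f : R[i] -> R[i]) :=
  exists2 C, 0 <= C & forall e, 0 < e -> exists2 p, coef_bounded p C &
    forall z, cabs z <= 1 -> cabs (f z - p.[z]) <= e.

Lemma complex_gt0 (e : R[i]) : 0 < e -> exists2 e' : R, 0 < e' & e = e'%:C.
Proof.
by case: e => a b; rewrite ltcE /= => /andP[/eqP -> a0]; exists a.
Qed.

Lemma limit_continuous (f : R[i]^o -> R[i]^o) : unif_poly_limit f ->
  {within [set z : R[i]^o | `|z| <= 1], continuous f}.
Proof.
move=> [C C0 H]; apply/subspace_continuousP => x /= x1.
apply/cvgrPdist_le => _ /complex_gt0[e e0 ->].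
have e30 : 0 < e / 3 by rewrite divr_gt0.
have [p _ pf] := H _ e30.
have [K K0 HK] := horner_lipschitz_disk p.
have K1 : 0 < K + 1 by rewrite ltr_wpDl.
have d0 : 0 < e / 3 / (K + 1) by rewrite divr_gt0.
rewrite near_withinE; near=> y => /= y1.
have : `|x - y| <= (e / 3 / (K + 1))%:C.
  by near: y; apply: cvgr_dist_le; rewrite ?ltcR //; exact: cvg_id.
rewrite !cabsE !lecR => xy.
move: x1 y1; rewrite !cabs_le1 => x1 y1.
have fx := pf _ x1; have fy := pf _ y1.
have {HK} pxy := HK _ _ x1 y1.
have {}pxy : cabs (p.[x] - p.[y]) <= e / 3.
  apply: le_trans pxy _; move: xy; rewrite ler_pdivlMr //.
  by have := cabs_ge0 (x - y); lra.
rewrite (_ : f x - f y = (f x - p.[x]) + (p.[x] - p.[y]) - (f y - p.[y]));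
  last first.
  by ring.
apply: le_trans (ler_cabsB _ _) _.
have := ler_cabsD (f x - p.[x]) (p.[x] - p.[y]); lra.
Unshelve. all: end_near. Qed.

Lemma limit_second_difference f : unif_poly_limit f ->
  forall r, r < 1 -> exists2 K, 0 <= K & forall x y z,
  cabs x <= r -> cabs y <= r -> cabs z <= r ->
  cabs ((f x - f z) * (y - z) - (f y - f z) * (x - z))
    <= K * (cabs (x - y) * cabs (x - z) * cabs (y - z)).
Proof.
move=> [C C0 H] r r1; exists (C / (1 - r) ^+ 3).
  by rewrite divr_ge0 // exprn_ge0 // subr_ge0 ltW.
move=> x y z xr yr zr.
pose L := 2 * (cabs (y - z) + cabs (x - z)).
apply: (@ler_gt0_addeps _ _ _ L) => [|e /H[p pC pf]].
  by rewrite mulr_ge0 // addr_ge0 ?cabs_ge0.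
have := horner_second_difference C0 r1 pC xr yr zr.
have le1 u : cabs u <= r -> cabs u <= 1 by move/le_trans; apply; exact: ltW.
have fx := pf _ (le1 _ xr); have fy := pf _ (le1 _ yr).
have fz := pf _ (le1 _ zr).
set P := _ - _ * (x - z) => PB.
rewrite (_ : _ - _ = P + (((f x - p.[x]) - (f z - p.[z])) * (y - z)
   - ((f y - p.[y]) - (f z - p.[z])) * (x - z))); last by rewrite /P; ring.
apply: le_trans (ler_cabsD _ _) _; apply: lerD => //.
apply: le_trans (ler_cabsB _ _) _; rewrite !cabsM /L.
rewrite (_ : 2 * _ * e = 2 * e * cabs (y - z) + 2 * e * cabs (x - z));
  last by ring.
apply: lerD; apply: ler_wpM2r; rewrite ?cabs_ge0 //;
  apply: le_trans (ler_cabsB _ _) _; lra.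
Qed.

(** By the bound on second differences the difference quotients at z satisfy
    |q h - q k| <= K (|h| + |k|); a common point of the disks of radius 2 K
    |h| around q h is their limit. *)
Lemma limit_derivable (f : R[i]^o -> R[i]^o) (z : R[i]^o) :
  unif_poly_limit f -> `|z| < 1 -> derivable f z 1.
Proof.
move=> fl; rewrite cabs_lt1 => z1; pose r := (1 + cabs z) / 2.
have zr : cabs z < r by rewrite /r; lra.
have r1 : r < 1 by rewrite /r; lra.
have [K K0 HK] := limit_second_difference fl r1.
pose B := [set h : R[i] | h != 0 /\ cabs h <= r - cabs z].
have B0 : B !=set0.
  exists (r - cabs z)%:C; split.
    by rewrite -[0]/(0%:C) (inj_eq (@complexI _)) gt_eqF // subr_gt0.
  by rewrite -lecR -cabsE ger0_norm // ler0c subr_ge0 ltW.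
have Br h : B h -> cabs (h + z) <= r.
  by move=> [_ hr]; have := ler_cabsD h z; lra.
pose q (h : R[i]) := h^-1 * (f (h + z) - f z).
have [||L HL] := @disk_helly R _ B q (fun h => K * cabs h) => //.
  move=> h k Bh Bk; have := HK (h + z) (k + z) z (Br _ Bh) (Br _ Bk) (ltW zr).
  rewrite !addrK.
  have -> : h + z - (k + z) = h - k by ring.
  case: Bh Bk => h0 _ [k0 _].
  have -> : (f (h + z) - f z) * k - (f (k + z) - f z) * h =
    (q h - q k) * (h * k).
    by rewrite /q; field; rewrite h0 k0.
  have -> : K * (cabs (h - k) * cabs h * cabs k) =
    K * cabs (h - k) * cabs (h * k).
    by rewrite (cabsM h) !mulrA.
  rewrite (cabsM _ (h * k)) ler_pM2r; last first.
    rewrite lt_neqAle cabs_ge0 andbT eq_sym; apply/eqP => /cabs_eq0/eqP.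
    by rewrite mulf_eq0 (negbTE h0) (negbTE k0).
  by move/le_trans; apply; rewrite -mulrDr ler_wpM2l // ler_cabsB.
apply/cvg_ex; exists (L : R[i]^o);
  apply/cvgrPdist_le => _ /complex_gt0[e e0 ->].
have K1 : 0 < 2 * K + 1 by rewrite ltr_wpDl // mulr_ge0.
pose d := Num.min (r - cabs z) (e / (2 * K + 1)).
have d0 : 0 < d by rewrite lt_min subr_gt0 zr divr_gt0.
have d0C : 0 < d%:C by rewrite ltcR.
near=> h.
have h0 : h != 0 by near: h; exact: nbhs_dnbhs_neq.
have : `|h| < d%:C.
  near: h; exact: dnbhs0_lt.
rewrite !cabsE ltcR lecR lt_min => /andP[hr hK].
have /HL : B h by split => //; exact: ltW.
rewrite /q [_ *: 1]mulr1; move/le_trans; apply.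
move: hK; rewrite ltr_pdivlMr // => /ltW; apply: le_trans.
by have := cabs_ge0 h; nra.
Unshelve. all: end_near. Qed.

Lemma limit_disk_algebra (f : R[i]^o -> R[i]^o) :
  unif_poly_limit f -> disk_algebra f.
Proof.
move=> fl; split; first exact: limit_continuous.
by move=> z; exact: limit_derivable.
Qed.

Lemma disk_algebra_rotate (f : R[i]^o -> R[i]^o) (c m : R[i]) : cabs m = 1 ->
  disk_algebra f -> disk_algebra (fun z : R[i]^o => c * f (m * z) : R[i]^o).
Proof.
move=> m1 [fc fd]; split.
  move: fc => /subspace_continuousP fc; apply/subspace_continuousP => x /= x1.
  have mx1 : `|m * x| <= 1 by rewrite normrM cabsE m1 mul1r.
  apply: cvgMl_tmp.
  have mc : {for x, continuous (fun z : R[i]^o => m * z : R[i]^o)}.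
    exact: (@mulrl_continuous _ m).
  pose A := [set z : R[i]^o | `|z| <= 1].
  have mw : (fun z : R[i]^o => m * z : R[i]^o) @ within A (nbhs x)
      --> within A (nbhs (m * x : R[i]^o)).
    move=> U HU; have {}HU : nbhs (m * x : R[i]^o) [set y | A y -> U y] by [].
    change (nbhs x [set y : R[i]^o | A y -> U (m * y)]).
    have := mc _ HU; apply: (@filterS _ (nbhs x)) => y Hy y1.
    by apply: Hy; rewrite /A /= normrM cabsE m1 mul1r.
  exact: cvg_comp mw (fc _ mx1).
move=> z z1.
have mz1 : `|m * z| < 1 by rewrite normrM cabsE m1 mul1r.
have m0 : m != 0 by apply: contra_eq_neq m1 => ->;
  rewrite cabs0 eq_sym oner_eq0.
have /cvg_ex[L fL] := fd _ mz1.
apply/cvg_ex; exists (c * m * L : R[i]^o).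
pose g (k : R[i]^o) : R[i]^o := k^-1 *: (f (k *: 1 + m * z) - f (m * z)).
have -> : (fun h : R[i]^o => h^-1 *: (c * f (m * (h *: 1 + z)) - c * f (m * z)))
    = (fun h : R[i]^o => (c * m * g (m * h) : R[i]^o)).
  apply/funext => h; rewrite /g /= ![_ *: 1]mulr1 mulrDr invfM -mulrBr.
  rewrite /GRing.scale /= !mulrA; congr (_ * _).
  by rewrite mulfK // mulrC.
have m0' : (fun h : R[i]^o => m * h : R[i]^o) @ (0 : R[i]^o)^' --> (0 :
  R[i]^o)^'.
  move=> U HU; have {}HU : nbhs (0 : R[i]^o) [set y | y != 0 -> U y] by [].
  change (nbhs (0 : R[i]^o) [set y : R[i]^o | y != 0 -> U (m * y)]).
  have mc : *%R m @ (0 : R[i]^o) --> (m * 0 : R[i]^o).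
    exact: (@mulrl_continuous _ m).
  rewrite mulr0 in mc; have := mc _ HU.
  apply: (@filterS _ (nbhs (0 : R[i]^o))) => y Hy y0.
  by apply: Hy; rewrite mulf_neq0.
apply: cvgMl_tmp.
exact: cvg_comp m0' fL.
Qed.

End DiskAlgebra.

(** * Square summable families *)

Section SquareSummable.
Variables (R : realType) (I : choiceType).
Implicit Types (x y : ell2 R I) (A B : ell2 R I -> ell2 R I) (c d e : R).

Definition sqnorm x : R := fine (\esum_(i in [set: I]) (sqmod (x i))%:E)%E.

Lemma esum_sqmod x : (\esum_(i in [set: I]) (sqmod (x i))%:E)%E = (sqnorm x)%:E.
Proof.
rewrite fineK // ge0_fin_numE; first by have := coordP x; rewrite inE.
by apply: esum_ge0 => i _; rewrite lee_fin sqmod_ge0.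
Qed.

Lemma sqnorm_ge0 x : 0 <= sqnorm x.
Proof.
by rewrite -lee_fin -esum_sqmod; apply: esum_ge0 => i _;
  rewrite lee_fin sqmod_ge0.
Qed.

Lemma ell2_norm_sqr x : ell2_norm x ^+ 2 = sqnorm x.
Proof. by rewrite sqr_sqrtr ?sqnorm_ge0. Qed.

Lemma coordD x y i : (x + y) i = x i + y i.
Proof. by []. Qed.

Lemma coordZ a x i : (a *: x) i = a * x i.
Proof. by []. Qed.

Lemma coord_sum (T : Type) (s : seq T) (P : pred T) (F : T -> ell2 R I) i :
  (\sum_(t <- s | P t) F t) i = \sum_(t <- s | P t) F t i.
Proof. by elim/big_rec2: _ => // t y z _ <-. Qed.

Lemma ell2P x y : (forall i, x i = y i) -> x = y.
Proof. by move=> xy; apply: val_inj; apply/funext. Qed.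

Lemma sqnormZ_le a x : sqnorm (a *: x) <= sqmod a * sqnorm x.
Proof.
rewrite -lee_fin -esum_sqmod EFinM -esum_sqmod.
apply: ge_ereal_sup => _ [F [Ffin FT] <-].
under eq_fsbigr do rewrite coordZ sqmodM EFinM.
rewrite -ge0_mule_fsumr; last by move=> i; rewrite lee_fin sqmod_ge0.
apply: lee_wpmul2l; first by rewrite lee_fin sqmod_ge0.
by apply: ereal_sup_ubound; exists F.
Qed.

Lemma sqnormD_le x y : sqnorm (x + y) <= 2 * sqnorm x + 2 * sqnorm y.
Proof.
pose a i := (sqmod (x i) + sqmod (y i))%:E.
have a0 i : [set: I] i -> (0 <= a i)%E by rewrite lee_fin addr_ge0 ?sqmod_ge0.
have aE : (sqnorm x + sqnorm y)%:E = (\esum_(i in [set: I]) a i)%E.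
  under eq_esum do rewrite /a EFinD.
  by rewrite esumD ?EFinD ?esum_sqmod // => i _; rewrite lee_fin sqmod_ge0.
rewrite -mulrDr mulrDl mul1r -lee_fin EFinD aE -esumD // -esum_sqmod.
apply: le_esum => i _; rewrite -!EFinD lee_fin.
apply: le_trans (sqmodD_le _ _) _; lra.
Qed.

Lemma fin_esum (T : finType) (P : pred T) (F : T -> R) : (forall t, 0 <= F t) ->
  (\esum_(t in [set t | P t]) (F t)%:E)%E = (\sum_(t | P t) F t)%:E.
Proof.
move=> F0; rewrite esum_fset; first last.
- by move=> t _; rewrite lee_fin.
- exact: finite_finset.
rewrite -sumEFin (@bigfs _ _ _ T (index_enum T) P) ?index_enum_uniq //.
by move=> t _; rewrite mem_index_enum.
Qed.

(** Bessel's inequality for basis vectors. *)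
Lemma sqnorm_ge_coords (T : finType) (P : pred T) (u : T -> I) x :
  {in P &, injective u} -> \sum_(t | P t) sqmod (x (u t)) <= sqnorm x.
Proof.
move=> uI; rewrite -lee_fin -esum_sqmod -fin_esum; last by move=> t;
  exact: sqmod_ge0.
rewrite -(esum_image _ u (fun i => (sqmod (x i))%:E)); last first.
  by move=> s t; rewrite !inE => Ps Pt; exact: uI.
rewrite esum_mkcond; apply: le_esum => i _.
by case: ifP => // _; rewrite lee_fin sqmod_ge0.
Qed.

Lemma sqmod_coord_le x i : sqmod (x i) <= sqnorm x.
Proof.
have := @sqnorm_ge_coords unit xpredT (fun=> i) x.
by rewrite big_const card_unit /= addr0; apply => -[] [].
Qed.

Lemma sqnorm_comb (T : finType) (P : pred T) (u : T -> I) (b : T -> R[i]) :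
  {in P &, injective u} ->
  sqnorm (\sum_(t | P t) b t *: xi R (u t)) <= \sum_(t | P t) sqmod (b t).
Proof.
move=> uI; rewrite -lee_fin -esum_sqmod -fin_esum; last by move=> t;
  exact: sqmod_ge0.
set x := \sum_(t | P t) _.
have xE i : x i = \sum_(t | P t) b t * (i == u t)%:R by rewrite coord_sum.
rewrite (@eq_esum _ _ _ _ (fun t => (sqmod (x (u t)))%:E)); last first.
  move=> t /= Pt; congr ((sqmod _)%:E).
  rewrite xE (bigD1 t) //= eqxx mulr1 big1 ?addr0 // => s /andP[Ps st].
  case: eqP => [/(uI _ _ Pt Ps) ts|_]; last by rewrite mulr0.
  by rewrite ts eqxx in st.
rewrite -(esum_image _ u (fun i => (sqmod (x i))%:E)); last first.
  by move=> s t; rewrite !inE => Ps Pt; exact: uI.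
rewrite [leRHS]esum_mkcond; apply: le_esum => i _.
case: ifPn => // /negP iP; rewrite xE big1 ?sqmod0 // => t Pt.
case: eqP => [iu|]; rewrite ?mulr0 //.
by case: iP; rewrite inE; exists t.
Qed.

Lemma sqnorm_xi_le u : sqnorm (xi R u) <= 1.
Proof.
have := @sqnorm_comb unit xpredT (fun=> u) (fun=> 1).
rewrite !big_const card_unit /= !addr0 scale1r /sqmod /= expr1n expr0n /= addr0.
by apply => -[] [].
Qed.

Lemma sqnorm_pull (g : I -> option I) (gI : pinj g) x :
  sqnorm (pull gI x) <= sqnorm x.
Proof.
rewrite -lee_fin -!esum_sqmod.
pose D := [set u | exists v, g u = Some v].
pose h u := odflt u (g u).
have hI : set_inj D h.
  move=> u1 u2; rewrite !inE => -[v1 E1] [v2 E2].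
  by rewrite /h E1 E2 /= => E; apply: (gI _ _ v1) => //; rewrite E2 E.
apply: (@le_trans _ _ (\esum_(u in D) (sqmod (x (h u)))%:E)%E).
  rewrite [leRHS]esum_mkcond; apply: le_esum => u _.
  rewrite /= /pull_fun; case: ifPn => [|uD].
    by rewrite inE => -[v E]; rewrite /h E.
  case E : (g u) => [v|]; last by rewrite sqmod0.
  by case/negP: uD; rewrite inE; exists v.
rewrite -(esum_image D h (fun i => (sqmod (x i))%:E)) //.
rewrite esum_mkcond; apply: le_esum => u _.
by case: ifP => // _; rewrite lee_fin sqmod_ge0.
Qed.

End SquareSummable.

(** * Operator bounds *)

Section Operators.
Variables (R : realType) (I : choiceType).
Local Notation H := (ell2 R I).
Implicit Types (x y : H) (A B : H -> H) (c d e : R).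

Lemma lin0 A : linear A -> A 0 = 0.
Proof. by move=> /(_ (-1) 0 0); rewrite scaler0 addr0 scaleN1r addNr. Qed.

Lemma linD A x y : linear A -> A (x + y) = A x + A y.
Proof. by move=> /(_ 1 x y); rewrite !scale1r. Qed.

Lemma linZ A a x : linear A -> A (a *: x) = a *: A x.
Proof. by move=> lA; have := lA a x 0; rewrite (lin0 lA) !addr0. Qed.

Lemma linB A x y : linear A -> A (x - y) = A x - A y.
Proof. by move=> lA; rewrite addrC -scaleN1r lA scaleN1r addrC. Qed.

Lemma lin_sum A (T : Type) (s : seq T) (P : pred T) (F : T -> H) : linear A ->
  A (\sum_(t <- s | P t) F t) = \sum_(t <- s | P t) A (F t).
Proof.
by move=> lA; elim/big_rec2: _ => [|t y z _ <-]; rewrite (lin0, linD) //;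
  exact: lin0.
Qed.

Lemma linear_comb a A B : linear A -> linear B -> linear (a *: A + B).
Proof.
move=> lA lB b u v.
change (a *: A (b *: u + v) + B (b *: u + v)
  = b *: (a *: A u + B u) + (a *: A v + B v)).
by rewrite lA lB !scalerDr !scalerA [a * b]mulrC addrACA.
Qed.

Lemma linear_comp A B : linear A -> linear B -> linear (A \o B).
Proof. by move=> lA lB b u v; rewrite /= lB lA. Qed.

Definition bounded_by A c := 0 <= c /\ forall x, sqnorm (A x) <=
  c ^+ 2 * sqnorm x.

(** The sign condition belongs to the predicate because c enters only
    through its square. *)
Definition mx_bounded_by k (M : 'M[H -> H]_k) c := 0 <= c /\
  forall x : 'I_k -> H, \sum_(s < k) sqnorm (\sum_(t < k) M s t (x t))
    <= c ^+ 2 * \sum_(t < k) sqnorm (x t).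

Lemma const_mx_bounded_by A c :
  mx_bounded_by (const_mx A : 'M[H -> H]_1) c <-> bounded_by A c.
Proof.
rewrite /mx_bounded_by /bounded_by; split=> -[c0 Ac]; split=> // x.
  by have := Ac (fun=> x); rewrite !big_ord1 mxE.
by rewrite !big_ord1 mxE.
Qed.

Lemma mxopnorm_mx_bounded_by k (M : 'M[H -> H]_k) c :
  (forall s t, linear (M s t)) ->
  0 <= c -> (mxopnorm (@ell2_norm R I) M <= c%:E)%E -> mx_bounded_by M c.
Proof.
move=> lM c0 Mc; split=> // x; set N := \sum_(t < k) sqnorm (x t).
have N0 : 0 <= N by apply: sumr_ge0 => t _; exact: sqnorm_ge0.
apply: (@ler_gt0_addeps _ _ _ (c ^+ 2)) => [|e e0]; first exact: exprn_ge0.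
rewrite -mulrDr; set r := N + e.
have r0 : 0 < r by rewrite ltr_wpDl.
(* Rescaling by N + e instead of N avoids a separate case N = 0. *)
pose a : R[i] := (Num.sqrt r)%:C.
have sa : sqmod a = r by rewrite /sqmod /= expr0n addr0 sqr_sqrtr // ltW.
have a0 : a != 0 by apply: contra_eq_neq sa => ->; rewrite sqmod0 lt_eqF.
have sV : sqmod a^-1 = r^-1.
  apply: (mulfI (lt0r_neq0 r0)); rewrite -{1}sa -sqmodM divff //.
  by rewrite divff ?gt_eqF // /sqmod /= expr1n expr0n addr0.
pose y t := a^-1 *: x t.
have xE t : x t = a *: y t by rewrite scalerA divff // scale1r.
have y1 : \sum_(t < k) ell2_norm (y t) ^+ 2 <= 1.
  apply: (@le_trans _ _ (\sum_(t < k) r^-1 * sqnorm (x t))).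
    by apply: ler_sum => t _; rewrite ell2_norm_sqr -sV sqnormZ_le.
  by rewrite -mulr_sumr mulrC ler_pdivrMr // mul1r lerDl ltW.
have : Num.sqrt (\sum_(s < k) ell2_norm (\sum_(t < k) M s t (y t)) ^+ 2) <= c.
  by rewrite -lee_fin; apply: le_trans Mc; apply: ereal_sup_ubound; exists y.
rewrite -(@ler_pXn2r _ 2) ?nnegrE ?sqrtr_ge0 // sqr_sqrtr; last first.
  by apply: sumr_ge0 => s _; exact: sqr_ge0.
move=> yc; rewrite mulrC; apply: le_trans (ler_wpM2l (ltW r0) yc).
rewrite mulr_sumr; apply: ler_sum => s _; rewrite ell2_norm_sqr.
rewrite (_ : \sum_(t < k) M s t (x t) = a *: \sum_(t < k) M s t (y t)).
  by rewrite -sa sqnormZ_le.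
by rewrite scaler_sumr; apply: eq_bigr => t _; rewrite xE linZ.
Qed.

Lemma mx_bounded_by_mxopnorm k (M : 'M[H -> H]_k) c :
  mx_bounded_by M c -> (mxopnorm (@ell2_norm R I) M <= c%:E)%E.
Proof.
move=> [c0 Mc]; apply: ge_ereal_sup => _ [x /= x1 <-]; rewrite lee_fin.
rewrite -(@ler_pXn2r _ 2) ?nnegrE ?sqrtr_ge0 // sqr_sqrtr; last first.
  by apply: sumr_ge0 => s _; exact: sqr_ge0.
under eq_bigr do rewrite ell2_norm_sqr.
apply: le_trans (Mc x) _; rewrite ler_piMr ?exprn_ge0 //.
by under eq_bigr do rewrite -ell2_norm_sqr.
Qed.

Lemma opnorm_bounded_by A c : linear A -> 0 <= c ->
  (opnorm (@ell2_norm R I) A <= c%:E)%E -> bounded_by A c.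
Proof.
move=> lA c0 Ac; apply/const_mx_bounded_by;
  apply: mxopnorm_mx_bounded_by => // s t.
by rewrite mxE.
Qed.

Lemma bounded_by_opnorm A c : bounded_by A c ->
  (opnorm (@ell2_norm R I) A <= c%:E)%E.
Proof. by move=> /const_mx_bounded_by; exact: mx_bounded_by_mxopnorm. Qed.

Lemma bounded_opsP A : bounded_ops (@ell2_norm R I) A <->
  linear A /\ exists c, bounded_by A c.
Proof.
split=> [[lA Aoo]|[lA [c Ac]]]; split=> //; last first.
  exact: le_lt_trans (bounded_by_opnorm Ac) (ltry _).
case E : (opnorm _ A) Aoo => [r| |] // _.
  exists (Num.max r 0); apply: opnorm_bounded_by => //;
    first by rewrite le_max lexx orbT.
  by rewrite E lee_fin le_max lexx.
by exists 0; apply: opnorm_bounded_by; rewrite // E leNye.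
Qed.

(** The factor 2 comes from using |x + y|^2 <= 2 |x|^2 + 2 |y|^2; the bound
    is only used to control small errors, where a constant factor is
    harmless. *)
Lemma bounded_byD A B c d : bounded_by A c -> bounded_by B d ->
  bounded_by (A + B) (2 * (c + d)).
Proof.
move=> [c0 Ac] [d0 Bd]; split=> [|x]; first by rewrite mulr_ge0 ?addr_ge0.
apply: le_trans (sqnormD_le _ _) _.
apply: (@le_trans _ _ ((2 * c ^+ 2 + 2 * d ^+ 2) * sqnorm x)).
  rewrite [leRHS]mulrDl; apply: lerD; rewrite -[leRHS]mulrA.
    by apply: ler_wpM2l => //; exact: Ac.
  by apply: ler_wpM2l => //; exact: Bd.
apply: ler_wpM2r; [exact: sqnorm_ge0|nra].
Qed.

Lemma bounded_byZ A a c : bounded_by A c -> bounded_by (a *: A) (cabs a * c).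
Proof.
move=> [c0 Ac]; split=> [|x]; first by rewrite mulr_ge0 ?cabs_ge0.
apply: le_trans (sqnormZ_le _ _) _; rewrite exprMn sqr_cabs -[leRHS]mulrA.
by apply: ler_wpM2l; [exact: sqmod_ge0|exact: Ac].
Qed.

Lemma bounded_by_comp A B c d : bounded_by A c -> bounded_by B d ->
  bounded_by (A \o B) (c * d).
Proof.
move=> [c0 Ac] [d0 Bd]; split=> [|x]; first exact: mulr_ge0.
apply: le_trans (Ac _) _; rewrite exprMn -[leRHS]mulrA.
by apply: ler_wpM2l; [exact: exprn_ge0|exact: Bd].
Qed.

Lemma bounded_byW A c d : bounded_by A c -> c <= d -> bounded_by A d.
Proof.
move=> [c0 Ac] cd; split=> [|x]; first exact: le_trans cd.
apply: le_trans (Ac x) _; apply: ler_wpM2r; first exact: sqnorm_ge0.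
by rewrite ler_pXn2r ?nnegrE // (le_trans c0).
Qed.

Lemma bounded_by_pull (g : I -> option I) (gI : pinj g) :
  bounded_by (pull gI) 1.
Proof. by split=> // x; rewrite expr1n mul1r sqnorm_pull. Qed.

Lemma linear_pull (g : I -> option I) (gI : pinj g) :
  linear (pull gI : H -> H).
Proof.
move=> a u v; apply: ell2P => i; rewrite coordD coordZ /= /pull_fun.
by case: (g i) => [j|]; rewrite ?coordD ?coordZ // mulr0 addr0.
Qed.

Lemma bounded_by_coord A c x i : bounded_by A c ->
  cabs (A x i) ^+ 2 <= c ^+ 2 * sqnorm x.
Proof.
by move=> [_ Ac]; rewrite sqr_cabs; exact: le_trans (sqmod_coord_le _ _) (Ac x).
Qed.

Lemma bounded_by_xi A c u i : bounded_by A c -> cabs (A (xi R u) i) <= c.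
Proof.
move=> Ac; have c0 := Ac.1; rewrite -(@ler_pXn2r _ 2) ?nnegrE ?cabs_ge0 //.
apply: le_trans (bounded_by_coord _ _ Ac) _.
by rewrite ler_piMr ?exprn_ge0 ?sqnorm_xi_le.
Qed.

End Operators.

Lemma mxopnorm_ge0 (R : realType) (V : lmodType R[i]) (nrm : V -> R) k (M :
  'M[V -> V]_k) :
  nrm 0 = 0 -> (0 <= mxopnorm nrm M)%E.
Proof.
move=> n0; pose v := Num.sqrt (\sum_(i < k) nrm (\sum_(j < k) M i j 0) ^+ 2).
apply: (@le_trans _ _ v%:E); first by rewrite lee_fin sqrtr_ge0.
apply: ereal_sup_ubound; exists (fun=> 0) => //=.
by rewrite big1 // => i _; rewrite n0 expr0n.
Qed.

Lemma ell2_norm0 (R : realType) (I : choiceType) : ell2_norm (0 : ell2 R I) = 0.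
Proof.
by rewrite /ell2_norm esum1 ?sqrtr0 // => i _; congr (_%:E); exact: sqmod0.
Qed.

Lemma cv_norm_sqr (R : realType) n (x : 'cV[R[i]]_n) :
  cv_norm x ^+ 2 = \sum_(i < n) sqmod (x i 0).
Proof. by rewrite sqr_sqrtr //; apply: sumr_ge0 => i _; exact: sqmod_ge0. Qed.

(** * Operators along a periodic path *)

Lemma sum_triangle (V : nmodType) d (F : nat -> nat -> V) :
  \sum_(c < d) \sum_(k < d - c) F c k
  = \sum_(e < d) \sum_(c < e.+1) F c (e - c)%N.
Proof.
transitivity (\sum_(c < d) \sum_(e < d | (c <= e)%N) F c (e - c)%N).
  apply: eq_bigr => c _.
  rewrite -(big_mkord xpredT (F c)) -(big_mkord (fun e => (c <= e)%N) (fun e =>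
    F c (e - c)%N)).
  rewrite [RHS](big_cat_nat (n := c)) ?(ltnW (ltn_ord c)) //=.
  rewrite [X in _ = X + _]big_nat_cond [X in _ = X + _]big_pred0 ?add0r;
    last first.
    by move=> e /=; case: ltnP; rewrite ?andbF.
  rewrite [RHS]big_nat_cond [RHS](eq_bigl (fun e => (c <= e < d)%N));
    last first.
    by move=> e; case: (c <= e)%N; rewrite ?andbT ?andbF.
  rewrite -[RHS]big_nat.
  have := @big_addn _ 0 +%R 0 d c xpredT (fun e => F c (e - c)%N).
  rewrite add0n => ->; by apply: eq_bigr => k _; rewrite addnK.
rewrite (exchange_big_dep xpredT) //=; apply: eq_bigr => e _.
by rewrite (big_ord_widen d (fun c => F c (e - c)%N)).
Qed.

Section PeriodicPath.
Variables (R : realType) (Q : digraph) (n : nat) (E : nat -> edge Q).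
Hypotheses (n_gt0 : (0 < n)%N) (E_periodic : forall k, E (k + n) = E k).
Hypothesis E_path : forall k, rng (E k.+1) = src (E k).
Local Notation H := (ell2 R (gpath Q)).
Implicit Types (A B : H -> H) (x y : H) (i j d m : nat) (z : R[i]).

Lemma arc_is_path i d :
  is_path [seq E k | k <- iota i.+1 d] (src (E (i + d))).
Proof.
elim: d i => // d IH i /=; rewrite addnS -addSn IH andbT.
by case: d {IH} => [|d]; rewrite /= ?addn0 ?E_path.
Qed.

Definition arc i d : gpath Q :=
  @GPath Q ([seq E k | k <- iota i.+1 d], src (E (i + d))) (arc_is_path i d).

Lemma E_mod i j : i = j %[mod n] -> E i = E j.
Proof.
have red k : E k = E (k %% n).
  rewrite {1}(divn_eq k n) addnC; elim: (k %/ n)%N => [|q IH];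
    first by rewrite addn0.
  by rewrite mulSn [(n + _)%N]addnC addnA E_periodic.
by move=> ij; rewrite red ij -red.
Qed.

(** Two arcs may be equal without their starting indices being congruent;
    only this direction holds. *)
Lemma arc_mod i j d : i = j %[mod n] -> arc i d = arc j d.
Proof.
move=> ij; apply: val_inj => /=.
have shift k : E (i + k) = E (j + k) by apply: E_mod;
  rewrite -modnDml ij modnDml.
congr (_, _); last by rewrite shift.
rewrite -[i.+1]addn1 -[j.+1]addn1 !iotaDl -!map_comp.
by apply: eq_map => k /=; rewrite shift.
Qed.

Lemma plen_arc i d : plen (arc i d) = d.
Proof. by rewrite /plen /= size_map size_iota. Qed.

Lemma arc_len i j d m : arc i d = arc j m -> d = m.
Proof. by move/(congr1 (@plen Q)); rewrite !plen_arc. Qed.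

Lemma Pmap_arc v i d :
  Pmap v (arc i d) = if src (E i) == v then Some (arc i d) else None.
Proof.
by rewrite /Pmap /prng /=; case: d => [|d] /=; rewrite /psrc /= ?addn0 ?E_path.
Qed.

Lemma Lmap_arc e i d :
  Lmap e (arc i d.+1) = if E i.+1 == e then Some (arc i.+1 d) else None.
Proof.
case: eqP => [<-|/eqP Ee]; last by rewrite /Lmap /= ifN.
by apply/eqP; rewrite Lmap_val /= /psrc /= addSnnS.
Qed.

(** The coefficient is read off from the basis vector at the source vertex
    of the arc, the arc of length 0 starting at i + d. *)
Definition coef A i d : R[i] := A (xi R (arc (i + d) 0)) (arc i d).

(** The trace on arcs of the fact that the path algebra commutes with right
    concatenation. Only finitely many coordinates of y enter, which makes it
    stable under composition without any convergence argument. *)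
Definition convolves A := forall y i d,
  A y (arc i d) = \sum_(c < d.+1) coef A i c * y (arc (i + c) (d - c)).

Lemma coef_mod A i j d : i = j %[mod n] -> coef A i d = coef A j d.
Proof.
move=> ij; rewrite /coef (arc_mod d ij) (@arc_mod (i + d) (j + d)) //.
by rewrite -modnDml ij modnDml.
Qed.

Lemma arc_eq0 i d : (arc i d == arc (i + d) 0) = (d == 0)%N.
Proof.
case: d => [|d]; first by rewrite addn0 eqxx.
by case: eqP => // /arc_len.
Qed.

Lemma coef_comb a A B i d : coef (a *: A + B) i d = a * coef A i d + coef B i d.
Proof. by []. Qed.

Lemma coef_Pop v i d :
  coef (Pop v) i d = ((src (E i) == v) && (d == 0)%N)%:R.
Proof.
by rewrite /coef /= /pull_fun Pmap_arc; case: ifP => //= _; rewrite arc_eq0.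
Qed.

Lemma coef_Lop e i d :
  coef (Lop e) i d = ((E i.+1 == e) && (d == 1)%N)%:R.
Proof.
rewrite /coef /= /pull_fun; case: d => [|d]; first by rewrite andbF.
by rewrite Lmap_arc; case: ifP => //= _; rewrite addnS -addSn arc_eq0.
Qed.

Lemma convolves_Pop v : convolves (Pop v).
Proof.
move=> y i d; rewrite big_ord_recl big1 => [|c _].
  rewrite coef_Pop eqxx andbT addn0 subn0 addr0 /= /pull_fun Pmap_arc.
  by case: ifP; rewrite ?mul1r ?mul0r.
by rewrite coef_Pop andbF mul0r.
Qed.

Lemma convolves_Lop e : convolves (Lop e).
Proof.
move=> y i d; rewrite /= /pull_fun; case: d => [|d].
  by rewrite big_ord1 coef_Lop andbF mul0r.
rewrite 2!big_ord_recl big1 => [|c _]; last by rewrite coef_Lop andbF mul0r.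
rewrite !coef_Lop andbF mul0r add0r addr0 Lmap_arc eqxx andbT addn1 subn1 /=.
by case: ifP; rewrite ?mul1r ?mul0r.
Qed.

Lemma convolves_comb a A B :
  convolves A -> convolves B -> convolves (a *: A + B).
Proof.
move=> cA cB y i d.
change (a * A y (arc i d) + B y (arc i d) =
  \sum_(c < d.+1) (a * coef A i c + coef B i c) * y (arc (i + c) (d - c))).
rewrite cA cB mulr_sumr -big_split; apply: eq_bigr => c _.
by rewrite mulrDl mulrA.
Qed.

Lemma coef_comp A B i d : convolves A ->
  coef (A \o B) i d = \sum_(c < d.+1) coef A i c * coef B (i + c) (d - c).
Proof.
move=> cA; rewrite /coef /= cA; apply: eq_bigr => c _.
by rewrite -addnA subnKC // -ltnS ltn_ord.
Qed.

Lemma convolves_comp A B : convolves A -> convolves B -> convolves (A \o B).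
Proof.
move=> cA cB y i d; rewrite /= cA.
transitivity (\sum_(c < d.+1) \sum_(k < d.+1 - c)
   coef A i c * coef B (i + c) k * y (arc (i + (c + k)) (d - (c + k)))).
  apply: eq_bigr => c _; rewrite cB mulr_sumr.
  rewrite subSn; last by rewrite -ltnS ltn_ord.
  by apply: eq_bigr => k _; rewrite mulrA addnA subnDA.
rewrite (sum_triangle _ (fun c k => coef A i c * coef B (i + c) k *
  y (arc (i + (c + k)) (d - (c + k))))).
apply: eq_bigr => e _; rewrite coef_comp // mulr_suml; apply: eq_bigr => c _.
by rewrite subnKC // -ltnS ltn_ord.
Qed.

(** The finitely supported operators need not be polynomials in the
    generators; what counts is that they form an algebra containing the
    generators on which symbols are polynomials. *)
Definition finite_type A D :=
  [/\ linear A, exists c, bounded_by A c, convolves A &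
  forall i d, (D <= d)%N -> coef A i d = 0].

Lemma finite_type_Pop v : finite_type (Pop v) 1.
Proof.
split; first exact: linear_pull.
- by exists 1; exact: bounded_by_pull.
- exact: convolves_Pop.
- by move=> i [|d] // _; rewrite coef_Pop andbF.
Qed.

Lemma finite_type_Lop e : finite_type (Lop e) 2.
Proof.
split; first exact: linear_pull.
- by exists 1; exact: bounded_by_pull.
- exact: convolves_Lop.
- by move=> i [|[|d]] // _; rewrite coef_Lop andbF.
Qed.

Lemma finite_type_comb a A B D D' : finite_type A D -> finite_type B D' ->
  finite_type (a *: A + B) (maxn D D').
Proof.
move=> [lA [c Ac] cA fA] [lB [c' Bc] cB fB]; split.
- exact: linear_comb.
- by exists (2 * (cabs a * c + c')); apply: bounded_byD => //;
    exact: bounded_byZ.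
- exact: convolves_comb.
- by move=> i d; rewrite geq_max => /andP[/fA{}fA /fB{}fB];
    rewrite coef_comb fA fB mulr0 addr0.
Qed.

Lemma finite_type_comp A B D D' : finite_type A D -> finite_type B D' ->
  finite_type (A \o B) (D + D').
Proof.
move=> [lA [c Ac] cA fA] [lB [c' Bc] cB fB]; split.
- exact: linear_comp.
- by exists (c * c'); exact: bounded_by_comp.
- exact: convolves_comp.
- move=> i d Dd; rewrite coef_comp // big1 // => k _.
  have [/fA ->|kD] := leqP D k; first by rewrite mul0r.
  by rewrite fB ?mulr0 //; lia.
Qed.

Definition symbol A D i j z : R[i] :=
  \sum_(d < D | ((i + d) %% n == j)%N) coef A i d * z ^+ d.

Lemma symbol_widen A D D' i j z : finite_type A D -> (D <= D')%N ->
  symbol A D' i j z = symbol A D i j z.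
Proof.
move=> [_ _ _ fA] DD'; rewrite /symbol.
rewrite [RHS](big_ord_widen_cond D' (fun d => ((i + d) %% n == j)%N) (fun d =>
  coef A i d * z ^+ d)) //.
rewrite [LHS](bigID (fun d : 'I_D' =>
  (d < D)%N)) /= [X in _ + X]big1 ?addr0 // => d.
by rewrite -leqNgt => /andP[_ /fA ->]; rewrite mul0r.
Qed.

Lemma symbol_comb a A B D i j z :
  symbol (a *: A + B) D i j z = a * symbol A D i j z + symbol B D i j z.
Proof.
rewrite /symbol mulr_sumr -big_split; apply: eq_bigr => d _.
by rewrite coef_comb mulrDl mulrA.
Qed.

(** A path of length c from i followed by one of length k contributes to
    z^(c+k); grouping by the index l of the intermediate vertex gives the
    matrix product. *)
Lemma symbol_comp A B D i j z : finite_type A D -> finite_type B D ->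
  symbol (A \o B) (D + D) i j z =
  \sum_(l < n) symbol A D i l z * symbol B D l j z.
Proof.
move=> FA FB; have [_ _ cA fA] := FA; have [_ _ _ fB] := FB.
pose F c k := if ((i + (c + k)) %% n == j)%N then
  coef A i c * coef B (i + c) k * z ^+ (c + k) else 0.
transitivity (\sum_(c < D + D) \sum_(k < D + D - c) F c k).
  rewrite sum_triangle /symbol big_mkcond; apply: eq_bigr => e _.
  rewrite coef_comp // mulr_suml; case: ifP => ej.
    apply: eq_bigr => c _; rewrite /F subnKC ?ej // -ltnS ltn_ord //.
  by rewrite big1 // => c _; rewrite /F subnKC ?ej // -ltnS ltn_ord.
transitivity (\sum_(c < D) \sum_(k < D) F c k).
  rewrite big_split_ord /= [X in _ + X]big1 ?addr0; last first.
    by move=> c _; apply: big1 => k _;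
      rewrite /F fA ?leq_addr // mul0r mul0r if_same.
  apply: eq_bigr => c _.
  have Dc : (D <= D + D - c)%N by have := ltn_ord c; lia.
  rewrite (big_ord_widen (D + D - c) (F c) Dc) [LHS](bigID (fun k : 'I_ _ =>
    (k < D)%N)) /=.
  rewrite [X in _ + X]big1 ?addr0 // => k; rewrite -leqNgt => kD.
  by rewrite /F fB // mulr0 mul0r if_same.
transitivity (\sum_(l < n) \sum_(c < D | ((i + c) %% n == l)%N) \sum_(k < D) F
  c k).
  pose key (c : 'I_D) := Ordinal (ltn_pmod (i + c) n_gt0).
  by rewrite (partition_big key xpredT).
apply: eq_bigr => l _; rewrite /symbol mulr_suml; apply: eq_bigr => c /eqP icl.
rewrite mulr_sumr [RHS]big_mkcond; apply: eq_bigr => k _.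
rewrite /F addnA -modnDml icl; case: ifP => // _.
rewrite (@coef_mod B (i + c) l); last by rewrite -icl modn_mod.
by rewrite exprD mulrACA.
Qed.

(** * Compressions to copies of the periodic path *)

(** The index modulo n at which the arc of length m from j stops; it labels
    the auxiliary tensor factor. *)
Definition endpoint N (p : 'I_n * 'I_N) : 'I_n :=
  Ordinal (ltn_pmod (p.1 + p.2) n_gt0).

(** Among arcs with a given label, the length determines the starting index;
    this is what the auxiliary factor is for. *)
Lemma arc_inj_endpoint N (r : 'I_n) :
  {in [pred p : 'I_n * 'I_N | endpoint p == r] &,
    injective (fun p : 'I_n * 'I_N => arc p.1 p.2)}.
Proof.
move=> [i m] [j m'] /=; rewrite !inE => /eqP <- /eqP pr /arc_len /= mm.
have {}mm : m = m' by apply: val_inj.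
move/(congr1 val): pr; rewrite mm /= => /eqP; rewrite eqn_modDr !modn_small //.
by move=> /eqP/val_inj ->.
Qed.

(** The r-th component, in the auxiliary tensor factor, of the combination
    with coefficients v of the unnormalized vectors \sum_(m < N) conj(z)^m
    xi_(arc j m) (x) b_(j+m). *)
Definition lifted N z (v : 'I_n -> R[i]) (r : 'I_n) : H :=
  \sum_(p : 'I_n * 'I_N | endpoint p == r)
    (z^* ^+ p.2 * v p.1) *: xi R (arc p.1 p.2).

Definition geom N z : R := \sum_(m < N) sqmod z ^+ m.

(** The matrix entry at (i,j) of the compression of A (x) 1. *)
Definition compression A N z (i j : 'I_n) : R[i] :=
  (geom N z)^-1%:C * \sum_(m < N) z ^+ m *
    \sum_(m' < N | endpoint (j, m') == endpoint (i, m))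
      z^* ^+ m' * A (xi R (arc j m')) (arc i m).

Lemma geom_gt0 N z : (0 < N)%N -> 0 < geom N z.
Proof.
case: N => // N _; rewrite /geom big_ord_recl expr0 ltr_wpDr //.
by apply: sumr_ge0 => m _; rewrite exprn_ge0 // sqmod_ge0.
Qed.

Lemma sqnorm_lifted N z v :
  \sum_(r < n) sqnorm (lifted N z v r) <=
    geom N z * \sum_(j < n) sqmod (v j).
Proof.
apply: (@le_trans _ _ (\sum_(r < n) \sum_(p : 'I_n * 'I_N | endpoint p == r)
   sqmod (z^* ^+ p.2 * v p.1))).
  by apply: ler_sum => r _; apply: sqnorm_comb; exact: arc_inj_endpoint.
rewrite (_ : \sum_(r < n) _ = \sum_(p :
  'I_n * 'I_N) sqmod (z^* ^+ p.2 * v p.1));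
  last by rewrite [RHS](partition_big (@endpoint N) xpredT).
rewrite -(pair_big xpredT xpredT (fun (j : 'I_n) (m : 'I_N) =>
  sqmod (z^* ^+ m * v j))) /=.
rewrite mulrC mulr_suml; apply: ler_sum => j _.
rewrite mulrC mulr_suml; apply: ler_sum => m _.
by rewrite sqmodM sqmodX sqmod_conj.
Qed.

Lemma compression_apply A N z v (i : 'I_n) : linear A ->
  \sum_(j < n) compression A N z i j * v j = (geom N z)^-1%:C *
    \sum_(m < N) z ^+ m * A (lifted N z v (endpoint (i, m))) (arc i m).
Proof.
move=> lA.
transitivity ((geom N z)^-1%:C * \sum_(j < n) \sum_(m < N) z ^+ m *
    \sum_(m' < N | endpoint (j, m') == endpoint (i, m))
      z^* ^+ m' * v j * A (xi R (arc j m')) (arc i m)).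
  rewrite mulr_sumr; apply: eq_bigr => j _.
  rewrite /compression -mulrA mulr_suml; congr (_ * _); apply: eq_bigr => m _.
  rewrite -mulrA mulr_suml; congr (_ * _); apply: eq_bigr => m' _.
  by rewrite mulrAC.
rewrite exchange_big; congr (_ * _); apply: eq_bigr => m _ /=.
rewrite -mulr_sumr; congr (_ * _).
rewrite pair_big_dep /= (lin_sum _ _ _ lA) coord_sum.
apply: eq_big => [[j m']|[j m'] _] //=.
by rewrite linZ // coordZ.
Qed.

(** The map V sending v to the components [lifted v r] / sqrt S is
    contractive by [sqnorm_lifted], its adjoint is contractive by Cauchy-
    Schwarz and Bessel, and M acts in between on each component r
    separately. *)
Lemma compression_contractive k (M : 'M[H -> H]_k) c N z
    (v : 'I_k -> 'I_n -> R[i]) :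
  (forall s t, linear (M s t)) -> mx_bounded_by M c -> (0 < N)%N ->
  \sum_(s < k) \sum_(i < n)
      sqmod (\sum_(t < k) \sum_(j < n) compression (M s t) N z i j * v t j)
    <= c ^+ 2 * \sum_(t < k) \sum_(j < n) sqmod (v t j).
Proof.
move=> lM [c0 Mc] N0; have S0 := geom_gt0 z N0; set S := geom N z in S0.
pose y s r := \sum_(t < k) M s t (lifted N z (v t) r).
(* Contractivity of the adjoint, one coordinate at a time. *)
have step s (i : 'I_n) :
    sqmod (\sum_(t < k) \sum_(j < n) compression (M s t) N z i j * v t j)
    <= S^-1 * \sum_(m < N) sqmod (y s (endpoint (i, m)) (arc i m)).
  under eq_bigr do rewrite compression_apply //.
  rewrite -mulr_sumr exchange_big /= sqmodM sqmod_real.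
  have -> : S^-1 * \sum_(m < N) sqmod (y s (endpoint (i, m)) (arc i m)) =
      S^-1 ^+ 2 * (S * \sum_(m < N) sqmod (y s (endpoint (i, m)) (arc i m))).
    by rewrite mulrA; congr (_ * _); field; rewrite gt_eqF.
  apply: ler_wpM2l; first exact: sqr_ge0.
  under eq_bigr do rewrite -mulr_sumr.
  apply: le_trans (cauchy_schwarz _ _ _ _) _.
  rewrite (eq_bigr (fun m : 'I_N => sqmod z ^+ m)); last by move=> m _;
    rewrite sqmodX.
  apply: ler_wpM2l; first exact: ltW.
  by apply: ler_sum => m _; rewrite /y coord_sum.
apply: (@le_trans _ _ (S^-1 * \sum_(s < k) \sum_(r < n) sqnorm (y s r))).
  rewrite mulr_sumr; apply: ler_sum => s _.
  apply: (@le_trans _ _ (\sum_(i < n) S^-1 *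
      \sum_(m < N) sqmod (y s (endpoint (i, m)) (arc i m)))).
    by apply: ler_sum => i _; exact: step.
  rewrite -mulr_sumr; apply: ler_wpM2l; first by rewrite invr_ge0 ltW.
  rewrite (pair_big xpredT xpredT (fun (i : 'I_n) (m : 'I_N) =>
    sqmod (y s (endpoint (i, m)) (arc i m)))) /=.
  rewrite (partition_big (@endpoint N) xpredT) //=; apply: ler_sum => r _.
  rewrite (eq_bigr (fun p : 'I_n * 'I_N => sqmod (y s r (arc p.1 p.2)))).
    by apply: sqnorm_ge_coords; exact: arc_inj_endpoint.
  by move=> [i m] /= /eqP ->.
rewrite exchange_big /=.
apply: (@le_trans _ _ (S^-1 * (c ^+ 2 *
    \sum_(t < k) \sum_(r < n) sqnorm (lifted N z (v t) r)))).
  apply: ler_wpM2l; first by rewrite invr_ge0 ltW.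
  rewrite [X in _ <= _ * X]exchange_big mulr_sumr.
  by apply: ler_sum => r _; exact: Mc.
rewrite mulrCA; apply: ler_wpM2l; first exact: exprn_ge0.
rewrite mulr_sumr; apply: ler_sum => t _.
by rewrite mulrC ler_pdivrMr // mulrC sqnorm_lifted.
Qed.

Lemma compression_bound A c N z (i j : 'I_n) : linear A -> bounded_by A c ->
  (0 < N)%N ->
  cabs (compression A N z i j) <= c.
Proof.
move=> lA Ac N0; have c0 := Ac.1.
rewrite -(@ler_pXn2r _ 2) ?nnegrE ?cabs_ge0 // sqr_cabs.
have lM (s t : 'I_1) : linear ((const_mx A : 'M[H -> H]_1) s t) by rewrite mxE.
have := compression_contractive z (fun _ (j' : 'I_n) => (j' == j)%:R) lM
  ((const_mx_bounded_by A c).2 Ac) N0.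
rewrite !big_ord1 [X in _ <= _ * X -> _](bigD1 j) //= eqxx.
rewrite [X in _ <= _ * (_ + X) -> _]big1 ?addr0 => [|j' /negbTE ->];
  last exact: sqmod0.
rewrite {2}/sqmod /= expr1n expr0n addr0 mulr1; apply: le_trans.
rewrite (bigD1 i) //= big_ord1 mxE (bigD1 j) //= eqxx mulr1.
rewrite [X in sqmod (_ + X)]big1 ?addr0 => [|j' /negbTE ->];
  last by rewrite mulr0.
by rewrite lerDl; apply: sumr_ge0 => i' _; exact: sqmod_ge0.
Qed.

(** The congruence makes the two arcs end at the same label, so the only
    factorization of arc i m ending in arc j m' is the evident one. *)
Lemma convolves_xi A i m j m' : convolves A -> i + m = j + m' %[mod n] ->
  A (xi R (arc j m')) (arc i m) = if (m' <= m)%N then coef A i (m - m') else 0.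
Proof.
move=> cA ij; rewrite cA /=; case: leqP => mm.
  have mm' : (m - m' < m.+1)%N by rewrite ltnS leq_subr.
  rewrite (bigD1 (Ordinal mm')) //= big1 ?addr0 => [|c cm].
    rewrite subKn // (@arc_mod _ j) ?eqxx ?mulr1 //.
    by apply/eqP; rewrite -(eqn_modDr m') -addnA subnK //; apply/eqP.
  case: eqP => [/arc_len mc|]; rewrite ?mulr0 //.
  case/eqP: cm; apply: val_inj => /=; have := ltn_ord c; lia.
rewrite big1 // => c _; case: eqP => [/arc_len mc|]; rewrite ?mulr0 //.
by have := ltn_ord c; lia.
Qed.

(** The compression is a weighted mean of truncations of the symbol. The
    weights |z|^(2m) decrease, so for large N the truncations dominate that
    are already complete. *)
Lemma compression_symbol A N z (i j : 'I_n) : convolves A ->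
  compression A N z i j =
  (geom N z)^-1%:C * \sum_(m < N) (sqmod z ^+ m)%:C * symbol A (N - m) i j z.
Proof.
move=> cA; rewrite /compression; congr (_ * _).
under eq_bigr do rewrite mulr_sumr.
rewrite (exchange_big_dep xpredT) //=; apply: eq_bigr => m' _.
rewrite /symbol mulr_sumr.
pose G m := if ((i + m) %% n == (j + m') %% n)%N then z ^+ m * (z^* ^+ m' *
  (if (m' <= m)%N then coef A i (m - m') else 0)) else 0.
transitivity (\sum_(m < N) G m).
  rewrite big_mkcond; apply: eq_bigr => m _; rewrite /G -val_eqE /= eq_sym.
  by case: eqP => // ij; rewrite (@convolves_xi A i m j m').
have NE : N = (m' + (N - m'))%N by rewrite subnKC // ltnW.
transitivity (\sum_(m < m' + (N - m')) G m); first by rewrite -NE.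
rewrite big_split_ord /= big1 ?add0r; last first.
  by move=> m _; rewrite /G leqNgt ltn_ord !mulr0 if_same.
rewrite [RHS]big_mkcond; apply: eq_bigr => d _.
rewrite /G addnCA [(j + m')%N]addnC eqn_modDl (modn_small (ltn_ord j)).
case: ifP => // _; rewrite leq_addr addKn.
rewrite exprD rmorphXn /= -mul_conj exprMn; ring.
Qed.

Lemma symbol_crude A c D i j z : bounded_by A c -> cabs z <= 1 ->
  cabs (symbol A D i j z) <= c * D%:R.
Proof.
move=> Ac z1; apply: le_trans (ler_cabs_sum _ _ _) _.
rewrite big_mkcond; apply: (@le_trans _ _ (\sum_(d < D) c)); last first.
  by rewrite sumr_const card_ord mulr_natr.
apply: ler_sum => d _; case: ifP => _; last exact: Ac.1.
rewrite cabsM cabsX; apply: le_trans (bounded_by_xi (arc (i + d) 0) (arc i d)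
  Ac).
by rewrite ler_piMr ?cabs_ge0 // exprn_ile1 ?cabs_ge0.
Qed.

Lemma compression_dist A c D K z (i j : 'I_n) : finite_type A D ->
  bounded_by A c ->
  cabs z <= 1 -> (0 < K)%N ->
  cabs (symbol A D i j z - compression A (K + D) z i j)
    <= 2 * c * D%:R ^+ 2 / K%:R.
Proof.
move=> FA Ac z1 K0; have [_ _ cA _] := FA; have c0 := Ac.1.
have S0 : 0 < geom (K + D) z by rewrite geom_gt0 // addn_gt0 K0.
have sz1 : sqmod z <= 1 by rewrite -sqr_cabs exprn_ile1 // cabs_ge0.
rewrite compression_symbol //; set S := geom _ _ in S0 *;
  set F := symbol A D i j z.
have -> : F = S^-1%:C * \sum_(m < K + D) (sqmod z ^+ m)%:C * F.
  rewrite -mulr_suml -rmorph_sum /= mulrA -rmorphM /= mulVf ?gt_eqF //.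
  by rewrite mul1r.
rewrite -mulrBr -sumrB cabsM.
have -> : cabs S^-1%:C = S^-1.
  by rewrite /cabs sqmod_real sqrtr_sqr ger0_norm // invr_ge0 ltW.
rewrite mulrC ler_pdivrMr //.
apply: (@le_trans _ _ ((2 * c * D%:R) * \sum_(m < D) sqmod z ^+ (K + m))).
  apply: le_trans (ler_cabs_sum _ _ _) _.
  (* For the first K indices the truncation is the whole symbol. *)
  rewrite big_split_ord /= big1 ?add0r => [|m _]; last first.
    rewrite /F (@symbol_widen A D (K + D - m)) ?subrr ?cabs0 //.
    by have := ltn_ord m; lia.
  rewrite mulr_sumr; apply: ler_sum => m _.
  rewrite -mulrBr cabsM /cabs sqmod_real sqrtr_sqr ger0_norm ?exprn_ge0
    ?sqmod_ge0 //.
  rewrite -/(cabs _) mulrC; apply: ler_wpM2r;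
    first by rewrite exprn_ge0 ?sqmod_ge0.
  apply: le_trans (ler_cabsB _ _) _.
  have h1 := symbol_crude D i j Ac z1.
  have h2 := symbol_crude (K + D - (K + m)) i j Ac z1.
  have : c * (K + D - (K + m))%:R <= c * D%:R.
    by apply: ler_wpM2l => //; rewrite ler_nat; lia.
  by rewrite /F; lra.
have K0' : 0 < K%:R :> R by rewrite ltr0n.
rewrite [leRHS]mulrAC ler_pdivlMr //.
have := geom_tail D K (sqmod_ge0 z) sz1; rewrite -/(geom _ _) -/S => T.
rewrite -[leLHS]mulrA [X in _ * X <= _]mulrC.
rewrite (_ : 2 * c * D%:R ^+ 2 * S = 2 * c * D%:R * (D%:R * S)); last by ring.
by apply: ler_wpM2l => //; rewrite !mulr_ge0.
Qed.

Lemma compression_cvg A D z (i j : 'I_n) e : finite_type A D -> cabs z <= 1 ->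
  0 < e -> exists N0, forall N, (N0 <= N)%N -> (0 < N)%N /\
    cabs (symbol A D i j z - compression A N z i j) <= e.
Proof.
move=> FA z1 e0; have [_ [c Ac] _ _] := FA; have c0 := Ac.1.
pose b := 2 * c * D%:R ^+ 2 / e.
exists ((Num.truncn b).+1 + D)%N => N DN.
have [K KE] : exists K, N = (K + D)%N by exists (N - D)%N; lia.
subst N; have {}DN : (Num.truncn b < K)%N by lia.
have K0 : (0 < K)%N by lia.
split; first by lia.
apply: le_trans (compression_dist i j FA Ac z1 K0) _.
have bK : b <= K%:R.
  have : b < (Num.truncn b).+1%:R by rewrite truncnS_gt.
  by move/ltW/le_trans; apply; rewrite ler_nat.
rewrite ler_pdivrMr ?ltr0n //; move: bK; rewrite /b ler_pdivrMr //.
by rewrite [leRHS]mulrC.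
Qed.

Lemma symbol_bound A c D z (i j : 'I_n) : finite_type A D -> bounded_by A c ->
  cabs z <= 1 -> cabs (symbol A D i j z) <= c.
Proof.
move=> FA Ac z1; have [lA _ _ _] := FA.
apply: (@ler_gt0_addeps _ _ _ 1) => // e e0; rewrite mul1r.
have [N0 /(_ N0 (leqnn _)) [N0_gt0 le]] := compression_cvg i j FA z1 e0.
have := compression_bound z i j lA Ac N0_gt0.
have := ler_cabsD (symbol A D i j z - compression A N0 z i j) (compression A N0
  z i j).
rewrite subrK; lra.
Qed.

(** * Extension to norm limits *)

(** The polynomial p with symbol z^k p(z^n), where k is the least exponent
    that occurs. *)
Definition symbol_poly A D i k : {poly R[i]} :=
  \poly_(q < D) coef A i (k + q * n).

Lemma cycle_exp_lt (i j : 'I_n) : (cycle_exp i j < n)%N.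
Proof. exact: ltn_pmod. Qed.

Lemma cycle_expP (i j : 'I_n) (r : 'I_n) :
  ((i + r) %% n == j)%N = (r == cycle_exp i j :> nat).
Proof.
have iK : ((i + cycle_exp i j) %% n = j)%N.
  rewrite /cycle_exp modnDmr subnKC ?modnDr ?modn_small //.
  by have := ltn_ord i; lia.
apply/eqP/eqP => [rj|->] //.
have : (i + r == i + cycle_exp i j %[mod n])%N by rewrite rj iK.
by rewrite eqn_modDl !modn_small ?cycle_exp_lt // => /eqP.
Qed.

Lemma symbol_poly_horner A D (i j : 'I_n) z :
  symbol A (D * n) i j z =
  z ^+ cycle_exp i j * (symbol_poly A D i (cycle_exp i j)).[z ^+ n].
Proof.
have kn := cycle_exp_lt i j.
rewrite horner_poly mulr_sumr; elim: D => [|D IH].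
  by rewrite /symbol mul0n !big_ord0.
rewrite big_ord_recr /= -IH mulSnr /symbol big_split_ord /=; congr (_ + _).
rewrite (big_pred1 (Ordinal kn)) => [|r] /=.
  by rewrite addnC [(D * n)%N]mulnC -exprM exprD mulrCA.
by rewrite addnCA -modnDml modnMl add0n cycle_expP.
Qed.

Lemma symbol_poly_coef A D c i k : bounded_by A c ->
  coef_bounded (symbol_poly A D i k) c.
Proof.
move=> Ac d; rewrite coef_poly; case: ifP => _; last by rewrite cabs0 Ac.1.
exact: bounded_by_xi.
Qed.

Lemma finite_typeW A D D' : finite_type A D -> (D <= D')%N -> finite_type A D'.
Proof.
by move=> [lA bA cA fA] DD; split => // i d /(leq_trans DD); exact: fA.
Qed.

Lemma symbol_poly_widen A D D' i k : finite_type A D -> (D <= D')%N ->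
  symbol_poly A D' i k = symbol_poly A D i k.
Proof.
move=> [_ _ _ fA] DD'; apply/polyP => d; rewrite !coef_poly.
case: ltnP => dD'; case: ltnP => // dD; last by lia.
by rewrite fA //; nia.
Qed.

Lemma symbol_poly_comb a A B D i k :
  symbol_poly (a *: A + B) D i k =
    a *: symbol_poly A D i k + symbol_poly B D i k.
Proof.
apply/polyP => d; rewrite coefD coefZ !coef_poly.
by case: ifP => _; rewrite ?coef_comb // mulr0 addr0.
Qed.

(** For |z| <= 1/2 the bound on the coefficients suffices. Otherwise divide
    the bound on the symbol at an n-th root y of z by |y|^k >= |z| >= 1/2;
    this avoids the maximum principle. *)
Lemma symbol_poly_bound A c D (i : 'I_n) k z : finite_type A D ->
  bounded_by A c ->
  cabs z <= 1 -> (k < n)%N -> cabs (symbol_poly A D i k).[z] <= 2 * c.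
Proof.
move=> FA Ac z1 kn; have c0 := Ac.1.
have [zs|zl] := leP (cabs z) 2^-1.
  have h1 : 2^-1 < 1 :> R by lra.
  apply: le_trans (horner_bound c0 h1 (symbol_poly_coef D i k Ac) zs) _.
  by rewrite (_ : 1 - 2^-1 = 2^-1) ?invrK 1?mulrC //; field.
pose y : R[i] := n.-root z.
have yz : y ^+ n = z by rewrite rootCK.
have yzc : cabs y ^+ n = cabs z by rewrite -cabsX yz.
have y1 : cabs y <= 1.
  rewrite leNgt; apply/negP => y1; move: z1; rewrite -yzc leNgt => /negP; apply.
  by rewrite exprn_egt1 // -lt0n.
pose j := Ordinal (ltn_pmod (i + k) n_gt0).
have kE : cycle_exp i j = k.
  by apply/esym/eqP; rewrite -(cycle_expP i j (Ordinal kn)) /=.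
have FA' : finite_type A (D * n) by apply: finite_typeW FA _; nia.
have := symbol_bound i j FA' Ac y1.
rewrite symbol_poly_horner kE yz cabsM cabsX.
have : 2^-1 <= cabs y ^+ k.
  apply: le_trans (ltW zl) _; rewrite -yzc.
  by apply: ler_wiXn2l => //; rewrite ?cabs_ge0 // ltnW.
move: (cabs_ge0 (symbol_poly A D i k).[z]).
set p := cabs _; set t := _ ^+ k => p0 t2 tp.
have : 2^-1 * p <= c by apply: le_trans tp; apply: ler_wpM2r.
lra.
Qed.

Definition approximant A e B D := finite_type B D /\ bounded_by (A - B) e.

(** Norm limits of finitely supported operators; a closed algebra that
    contains the path algebra. *)
Definition approximable A := [/\ linear A, exists c, bounded_by A c &
  forall e, 0 < e -> exists B D, approximant A e B D].

Lemma oppE (A B : H -> H) : A - B = (-1) *: B + A.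
Proof. by rewrite scaleN1r addrC. Qed.

Lemma approximant_diff A B B' D D' e e' : approximant A e B D ->
  approximant A e' B' D' ->
  finite_type (B - B') (maxn D' D) /\ bounded_by (B - B') (2 * (e + e')).
Proof.
move=> [FB Be] [FB' Be']; split; first by rewrite oppE; exact: finite_type_comb.
have -> : B - B' = (-1) *: (A - B) + (A - B').
  by rewrite scaleN1r opprB addrA subrK.
by apply: bounded_byD => //; have := bounded_byZ (-1) Be;
  rewrite cabsN cabs1 mul1r.
Qed.

(** The value at z of the limit of the polynomials of the approximants of A,
    singled out by its distance to all of them. *)
Definition disk_fun A (i : 'I_n) k z : R[i] :=
  xget 0 [set u | forall B D e, approximant A e B D ->
    cabs (u - (symbol_poly B D i k).[z]) <= 8 * e].

Lemma disk_fun_approx A (i : 'I_n) k z B D e : approximable A -> cabs z <= 1 ->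
  (k < n)%N -> approximant A e B D ->
  cabs (disk_fun A i k z - (symbol_poly B D i k).[z]) <= 8 * e.
Proof.
move=> [_ _ Aapp] z1 kn; move: B D e;
  pose P := [set u | forall B D e, approximant A e B D ->
    cabs (u - (symbol_poly B D i k).[z]) <= 8 * e].
suff: P (disk_fun A i k z) by apply.
apply: (@xgetPex _ 0 P).
pose T := ((H -> H) * nat * R)%type.
pose S := [set t : T | approximant A t.2 t.1.1 t.1.2].
have S0 : S !=set0 by have [B [D BD]] := Aapp 1 ltr01; exists (B, D, 1).
(* Two approximants with errors e and e' differ by at most 2 (e + e') in
   norm, hence their polynomials by twice that. *)
have [|u Hu] := @disk_helly R T S (fun t => (symbol_poly t.1.1 t.1.2 i k).[z])
    (fun t => 4 * t.2) S0.
  move=> [[B D] e] [[B' D'] e'] /= Be Be'.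
  have [FBB obb] := approximant_diff Be Be'.
  have := symbol_poly_bound i FBB obb z1 kn.
  rewrite oppE symbol_poly_comb hornerD hornerZ mulN1r addrC.
  rewrite (symbol_poly_widen i k Be.1 (leq_maxr _ _)).
  rewrite (symbol_poly_widen i k Be'.1 (leq_maxl _ _)) /=; lra.
exists u => B D e Be; apply: le_trans (Hu (B, D, e) Be) _ => /=; lra.
Qed.

Lemma approximant_refl B D : finite_type B D -> approximant B 0 B D.
Proof.
move=> FB; split=> //; rewrite subrr; split=> // x.
change (sqnorm (0 : H) <= 0 ^+ 2 * sqnorm x).
by rewrite -(scale0r x); apply: le_trans (sqnormZ_le _ _) _;
  rewrite sqmod0 expr0n.
Qed.

Lemma disk_fun_disk_algebra A (i : 'I_n) k : approximable A -> (k < n)%N ->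
  @disk_algebra R (disk_fun A i k).
Proof.
move=> FA kn; apply: limit_disk_algebra; have [_ [c Ac] Aapp] := FA.
have c0 := Ac.1.
exists (2 * (c + 1)) => [|e e0]; first lra.
(* The cap at 1 keeps the coefficients of all approximants below a common
   bound. *)
have e'0 : 0 < Num.min (e / 8) 1 by rewrite lt_min ltr01 divr_gt0.
have [B [D Be]] := Aapp _ e'0; exists (symbol_poly B D i k).
  apply: symbol_poly_coef.
  have -> : B = (-1) *: (A - B) + A by rewrite scaleN1r opprB subrK.
  have := bounded_byD (bounded_byZ (-1) Be.2) Ac;
    rewrite cabsN cabs1 mul1r => /bounded_byW; apply.
  by rewrite ler_pM2l // addrC lerD2l ge_min lexx orbT.
move=> z z1; apply: le_trans (disk_fun_approx i FA z1 kn Be) _.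
have : Num.min (e / 8) 1 <= e / 8 by rewrite ge_min lexx.
lra.
Qed.

Definition cycle_rep A : cdisk R -> 'M[R[i]]_n := fun z : cdisk R =>
  \matrix_(i, j)
  (cdval z ^+ cycle_exp i j * disk_fun A i (cycle_exp i j) (cdval z ^+ n)).

Lemma cdisk_cabs (z : cdisk R) : cabs (cdval z) <= 1.
Proof. by rewrite -cabs_le1; exact: cdvalP. Qed.

Lemma cycle_rep_approx A B D e (z : cdisk R) (i j : 'I_n) : approximable A ->
  approximant A e B D -> cabs (cycle_rep A z i j - symbol B D i j (cdval z)) <=
    8 * e.
Proof.
move=> FA Be; have z1 := cdisk_cabs z.
have Dn : (D <= D * n)%N by nia.
rewrite mxE -(symbol_widen i j _ Be.1 Dn).
rewrite symbol_poly_horner -mulrBr cabsM cabsX.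
have zn1 : cabs (cdval z ^+ n) <= 1 by rewrite cabsX exprn_ile1 ?cabs_ge0.
apply: le_trans (disk_fun_approx i FA zn1 (cycle_exp_lt i j) Be).
by rewrite ler_piMl ?cabs_ge0 // exprn_ile1 ?cabs_ge0.
Qed.

Lemma cycle_rep_dom A : approximable A -> @cycle_dom R n (cycle_rep A).
Proof.
move=> FA i j; exists (disk_fun A i (cycle_exp i j)).
  by apply: disk_fun_disk_algebra => //; exact: cycle_exp_lt.
by move=> z; rewrite mxE.
Qed.

Lemma approximant_comb a A A' B B' D D' e e' : approximant A e B D ->
  approximant A' e' B' D' ->
  approximant (a *: A + A') (2 * (cabs a * e + e')) (a *: B + B') (maxn D D').
Proof.
move=> [FB Be] [FB' Be']; split; first exact: finite_type_comb.
have -> : a *: A + A' - (a *: B + B') = a *: (A - B) + (A' - B').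
  by rewrite opprD addrACA scalerBr.
by apply: bounded_byD => //; exact: bounded_byZ.
Qed.

Lemma approximant_bounded_by A B D c e : approximant A e B D ->
  bounded_by A c -> bounded_by B (2 * (e + c)).
Proof.
move=> [_ Be] Ac; have -> : B =
  (-1) *: (A - B) + A by rewrite scaleN1r opprB subrK.
by apply: bounded_byD => //; have := bounded_byZ (-1) Be;
  rewrite cabsN cabs1 mul1r.
Qed.

Lemma approximant_comp A A' B B' D D' c c' e e' : linear A -> bounded_by A c ->
  bounded_by B' c' ->
  approximant A e B D -> approximant A' e' B' D' ->
  approximant (A \o A') (2 * (c * e' + e * c')) (B \o B') (D + D').
Proof.
move=> lA Ac Bc [FB Be] [FB' Be']; split; first exact: finite_type_comp.
have -> : (A \o A') - (B \o B') = (A \o (A' - B')) + ((A - B) \o B').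
  apply/funext => x.
  change (A (A' x) - B (B' x) = A (A' x - B' x) + (A (B' x) - B (B' x))).
  by rewrite (linB _ _ lA) addrA subrK.
by apply: bounded_byD; exact: bounded_by_comp.
Qed.

Lemma approximable_finite B D : finite_type B D -> approximable B.
Proof.
move=> FB; have [lB bB _ _] := FB; split=> // e e0; exists B, D.
by have [_ h] := approximant_refl FB; split => //;
  apply: bounded_byW h (ltW e0).
Qed.

Lemma approximable_comb a A B :
  approximable A -> approximable B -> approximable (a *: A + B).
Proof.
move=> [lA [c Ac] nA] [lB [c' Bc] nB]; split; first exact: linear_comb.
  by exists (2 * (cabs a * c + c')); apply: bounded_byD => //;
    exact: bounded_byZ.
move=> e e0; pose K := 2 * (cabs a + 1).
have K0 : 0 < K by rewrite mulr_gt0 // ltr_wpDl ?cabs_ge0.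
have [A' [D AD]] := nA _ (divr_gt0 e0 K0).
have [B' [D' BD]] := nB _ (divr_gt0 e0 K0).
exists (a *: A' + B'), (maxn D D'); have := approximant_comb a AD BD.
by rewrite (_ : 2 * _ = e) //; rewrite /K; field;
  rewrite gt_eqF // ltr_wpDl ?cabs_ge0.
Qed.

(** The error of a product involves a bound for the approximant of the
    second factor; capping the errors at 1 makes that bound uniform. *)
Lemma approximable_comp A B :
  approximable A -> approximable B -> approximable (A \o B).
Proof.
move=> [lA [c Ac] nA] [lB [c' Bc] nB]; split; first exact: linear_comp.
  by exists (c * c'); exact: bounded_by_comp.
move=> e e0; have c0 := Ac.1; have c0' := Bc.1.
pose K := 2 * (c + 2 * (1 + c')).
have K0 : 0 < K by rewrite /K; lra.
pose d := Num.min (e / K) 1.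
have d0 : 0 < d by rewrite lt_min divr_gt0 //=.
have [A' [D AD]] := nA _ d0; have [B' [D' BD]] := nB _ d0.
have B'c : bounded_by B' (2 * (1 + c')).
  by apply: bounded_byW (approximant_bounded_by BD Bc) _;
    rewrite ler_pM2l // lerD2r ge_min lexx orbT.
exists (A' \o B'), (D + D')%N; have [F N] := approximant_comp lA Ac B'c AD BD.
split=> //; apply: bounded_byW N _.
rewrite [d * _]mulrC -mulrDl mulrA -/K mulrC -ler_pdivlMr //.
by rewrite ge_min lexx.
Qed.

Lemma approximable_closed A : bounded_ops (@ell2_norm R (gpath Q)) A ->
  (forall e, 0 < e -> exists2 B, approximable B &
     (opnorm (@ell2_norm R (gpath Q)) (A - B)%R < e%:E)%E) -> approximable A.
Proof.
move=> /bounded_opsP[lA bA] H; split=> // e e0.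
have e4 : 0 < e / 4 by rewrite divr_gt0.
have [B [lB bB nB] AB] := H _ e4.
have lAB : linear (A - B) by rewrite oppE; exact: linear_comb.
have {}AB := opnorm_bounded_by lAB (ltW e4) (ltW AB).
have [B' [D [F BB]]] := nB _ e4; exists B', D; split=> //.
have -> : A - B' = (A - B) + (B - B') by rewrite addrA subrK.
by have := bounded_byD AB BB; rewrite (_ : 2 * _ = e) //; field.
Qed.

Lemma approximable_subalg :
  is_closed_subalg (@ell2_norm R (gpath Q)) approximable.
Proof.
have F0 : finite_type 0 0.
  split.
  - by move=> a x y; rewrite scaler0 addr0.
  - by exists 0; have [_] := approximant_refl (finite_type_Pop (src (E 0)));
      rewrite subrr.
  - by move=> y i d; rewrite big1 // => c _; rewrite mul0r.
  - by [].
split.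
- by move=> A [lA bA _]; apply/bounded_opsP.
- exact: approximable_finite F0.
- exact: approximable_comb.
- exact: approximable_comp.
- exact: approximable_closed.
Qed.

Lemma toeplitz_approximable A : oa_dom (toeplitz R Q) A -> approximable A.
Proof.
apply; split; first exact: approximable_subalg.
move=> _ [[v _ <-]|[e _ <-]].
  exact: approximable_finite (finite_type_Pop v).
exact: approximable_finite (finite_type_Lop e).
Qed.

Lemma cycle_rep_comb a A B (z : cdisk R) : approximable A -> approximable B ->
  cycle_rep (a *: A + B) z = a *: cycle_rep A z + cycle_rep B z.
Proof.
move=> FA FB; apply/matrixP => i j; rewrite [RHS]mxE [X in _ = X + _]mxE.
apply: (@complex_eq_small _ _ _ (24 * (cabs a + 1))) => [|e e0 _].
  by have := cabs_ge0 a; lra.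
have [_ _ /(_ _ e0) [A' [D AD]]] := FA; have [_ _ /(_ _ e0) [B' [D' BD]]] := FB.
have h1 := cycle_rep_approx z i j (approximable_comb a FA FB) (approximant_comb
  a AD BD).
have h2 := cycle_rep_approx z i j FA AD;
  have h3 := cycle_rep_approx z i j FB BD.
move: h1; rewrite symbol_comb (symbol_widen _ _ _ AD.1 (leq_maxl _ _)).
rewrite (symbol_widen _ _ _ BD.1 (leq_maxr _ _)).
move=> h1; apply: le_trans (cabs_comb_dist h1 h2 h3) _; lra.
Qed.

Lemma cycle_rep_crude A c (z : cdisk R) (i j : 'I_n) : approximable A ->
  bounded_by A c -> cabs (cycle_rep A z i j) <= 2 * c + 10.
Proof.
move=> FA Ac; have [_ _ /(_ _ ltr01) [B [D BD]]] := FA.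
have h1 := cycle_rep_approx z i j FA BD.
have h2 := symbol_bound i j BD.1 (approximant_bounded_by BD Ac) (cdisk_cabs z).
have := ler_cabsD (cycle_rep A z i j - symbol B D i j (cdval z))
  (symbol B D i j (cdval z)).
rewrite subrK; lra.
Qed.

(** By density: both sides are within a multiple of e of the product of the
    symbols of e-approximants. *)
Lemma cycle_rep_comp A B (z : cdisk R) : approximable A -> approximable B ->
  cycle_rep (A \o B) z = cycle_rep A z *m cycle_rep B z.
Proof.
move=> FA FB; apply/matrixP => i j; rewrite [RHS]mxE.
have [lA [c Ac] nA] := FA; have [_ [c' Bc] nB] := FB.
have c0 := Ac.1; have c0' := Bc.1.
pose L := 8 * (2 * c' + 10) + (2 * c + 10) * 8.
pose K := 16 * (c + 2 * (1 + c')) + n%:R * L.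
have L0 : 0 <= L by rewrite /L; lra.
have K0 : 0 <= K by rewrite addr_ge0 ?mulr_ge0 //; lra.
apply: (complex_eq_small K0) => e e0 e1.
have [A' [D AD]] := nA _ e0; have [B' [D' BD]] := nB _ e0.
pose D0 := maxn D D'.
have {}AD : approximant A e A' D0 by split;
  [exact: finite_typeW AD.1 (leq_maxl _ _)|exact: AD.2].
have {}BD : approximant B e B' D0 by split;
  [exact: finite_typeW BD.1 (leq_maxr _ _)|exact: BD.2].
have B'c : bounded_by B' (2 * (1 + c')).
  by apply: bounded_byW (approximant_bounded_by BD Bc) _; lra.
have N := approximant_comp lA Ac B'c AD BD.
have h1 := cycle_rep_approx z i j (approximable_comp FA FB) N.
rewrite (symbol_comp i j _ AD.1 BD.1) in h1.
pose s := \sum_(l < n) symbol A' D0 i l (cdval z) * symbol B' D0 l j (cdval z).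
pose t := \sum_(l < n) ((cycle_rep A z i l - symbol A' D0 i l (cdval z)) *
  cycle_rep B z l j
  + symbol A' D0 i l (cdval z) * (cycle_rep B z l j - symbol B' D0 l j (cdval
      z))).
have -> : \sum_(l < n) cycle_rep A z i l * cycle_rep B z l j = s + t.
  by rewrite -big_split /=; apply: eq_bigr => l _; ring.
have tL : cabs t <= n%:R * L * e.
  apply: le_trans (ler_cabs_sum _ _ _) _.
  apply: (@le_trans _ _ (\sum_(l < n) L * e)); last first.
    by rewrite sumr_const card_ord -mulrA mulr_natl.
  apply: ler_sum => l _; apply: le_trans (ler_cabsD _ _) _; rewrite !cabsM.
  rewrite (_ : L * e = 8 * e * (2 * c' + 10) + (2 * c + 10) * (8 * e));
    last first.
    by rewrite /L; ring.
  apply: lerD; apply: ler_pM; rewrite ?cabs_ge0 //.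
  - exact: cycle_rep_approx.
  - exact: cycle_rep_crude.
  - have := symbol_bound i l AD.1 (approximant_bounded_by AD Ac) (cdisk_cabs
      z); lra.
  - exact: cycle_rep_approx.
rewrite opprD addrA; apply: le_trans (ler_cabsB _ _) _.
rewrite /K mulrDl; apply: lerD => //; apply: le_trans h1 _.
by rewrite (_ : _ * (_ * _) = 16 * (c + 2 * (1 + c')) * e) //; ring.
Qed.

Lemma cycle_rep_finite B D (z : cdisk R) (i j : 'I_n) : finite_type B D ->
  cycle_rep B z i j = symbol B D i j (cdval z).
Proof.
move=> FB; apply: (@complex_eq_small _ _ _ 0) => // e _ _; rewrite mul0r.
have := cycle_rep_approx z i j (approximable_finite FB) (approximant_refl FB).
by rewrite mulr0.
Qed.

Lemma cycle_rep_Pop v : cycle_rep (Pop v) =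
  fun=> \sum_(j < n | src (E j) == v) delta_mx j j.
Proof.
apply/funext => z; apply/matrixP => i j.
rewrite (cycle_rep_finite z i j (finite_type_Pop v)) summxE /symbol.
rewrite big_mkcond big_ord1 /= addn0 modn_small // coef_Pop eqxx andbT expr0
  mulr1.
under [RHS]eq_bigr do rewrite mxE.
case: (eqVneq (i : nat) j) => [/val_inj <-|ij].
  case: (boolP (src (E i) == v)) => sv.
    rewrite (bigD1 i) //= eqxx big1 ?addr0 // => l /andP[_ /negbTE li].
    by rewrite eq_sym li.
  rewrite big1 // => l sl; case: (i =P l) => // il.
  by move: sv; rewrite il sl.
rewrite big1 // => l _; case: (i =P l) => // il; case: (j =P l) => // jl.
by rewrite il jl eqxx in ij.
Qed.

Lemma cycle_rep_Lop e : cycle_rep (Lop e) =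
  \sum_(j < n | E j == e) Zgen (R := R) (ord_pred j).
Proof.
apply/funext => z; apply/matrixP => i j.
rewrite (cycle_rep_finite z i j (finite_type_Lop e)) fct_sumE summxE /symbol.
rewrite big_mkcond 2!big_ord_recl big_ord0 /= coef_Lop andbF mul0r if_same
  add0r addr0.
rewrite coef_Lop andbT /bump /= addn1 expr1.
under [RHS]eq_bigr do rewrite /Zgen !mxE ord_predK.
have iE : (i == ord_pred j) = (i.+1 %% n == j)%N.
  by rewrite -(inj_eq (can_inj (@ordSK n))) ord_predK -val_eqE.
have big1' : (~~ ((E j == e) && (i == ord_pred j))) ->
   \sum_(j0 < n | E j0 == e) (cdval z * ((i == ord_pred j0) && (j == j0))%:R) =
     0.
  move=> ne; apply: big1 => l El; case: (j =P l) => [jl|];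
    last by rewrite andbF mulr0.
  by move: ne; rewrite jl El /= => /negbTE ->; rewrite mulr0.
case: ifP => ij; last by rewrite big1' // iE ij andbF.
have Eij : E i.+1 = E j by apply: E_mod; rewrite (eqP ij) modn_small.
rewrite Eij; case: (boolP (E j == e)) => Ee;
  last by rewrite big1' ?(negbTE Ee) // mul0r.
rewrite (bigD1 j) //= iE ij eqxx mulr1 mul1r big1 ?addr0 // =>
  l /andP[_ /negbTE lj].
by rewrite [j == l]eq_sym lj andbF mulr0.
Qed.

Lemma compressionB A B N z (i j : 'I_n) :
  compression (A - B) N z i j = compression A N z i j - compression B N z i j.
Proof.
rewrite /compression -mulrBr -sumrB; congr (_ * _); apply: eq_bigr => m _.
by rewrite -mulrBr -sumrB; congr (_ * _); apply: eq_bigr => m' _;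
  rewrite -mulrBr.
Qed.

(** Compressions are contractive on all bounded operators, so their
    convergence passes from approximants to A. *)
Lemma cycle_rep_cvg A (z : cdisk R) (i j : 'I_n) e : approximable A -> 0 < e ->
  exists N0, forall N, (N0 <= N)%N -> (0 < N)%N /\
    cabs (cycle_rep A z i j - compression A N (cdval z) i j) <= e.
Proof.
move=> FA e0; have e10 : 0 < e / 10 by rewrite divr_gt0.
have [lA _ nA] := FA; have [B [D BD]] := nA _ e10.
have z1 := cdisk_cabs z.
have [N0 HN] := compression_cvg i j BD.1 z1 e10.
exists N0 => N /HN[N_gt0 h2]; split => //.
have h1 := cycle_rep_approx z i j FA BD.
have [lB _ _ _] := BD.1.
have lAB : linear (A - B) by rewrite oppE; exact: linear_comb.
have h3 := compression_bound (cdval z) i j lAB BD.2 N_gt0.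
rewrite compressionB cabsB in h3.
have := ler_cabsD (cycle_rep A z i j - symbol B D i j (cdval z))
  (symbol B D i j (cdval z) - compression A N (cdval z) i j).
have := ler_cabsD (symbol B D i j (cdval z) - compression B N (cdval z) i j)
  (compression B N (cdval z) i j - compression A N (cdval z) i j).
rewrite !addrA !subrK; lra.
Qed.

(** The compressions of each M s t converge to the entries of its image, and
    they are jointly contractive for every N; a finite maximum gives one N
    for all entries. *)
Lemma cycle_rep_contractive k (M : 'M[H -> H]_k) c (z : cdisk R)
    (v : 'I_k -> 'I_n -> R[i]) : (forall s t, approximable (M s t)) ->
      mx_bounded_by M c ->
  \sum_(s < k) \sum_(i < n)
      sqmod (\sum_(t < k) \sum_(j < n) cycle_rep (M s t) z i j * v t j)
    <= c ^+ 2 * \sum_(t < k) \sum_(j < n) sqmod (v t j).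
Proof.
move=> FM Mc; set V := \sum_(t < k) \sum_(j < n) sqmod (v t j).
have V0 : 0 <= V by apply: sumr_ge0 => t _; apply: sumr_ge0 => j _;
  exact: sqmod_ge0.
have lM s t : linear (M s t) by have [] := FM s t.
pose L := \sum_(t < k) \sum_(j < n) cabs (v t j).
have L0 : 0 <= L by apply: sumr_ge0 => t _; apply: sumr_ge0 => j _;
  exact: cabs_ge0.
have CV0 : 0 <= c ^+ 2 * V by rewrite mulr_ge0 // exprn_ge0 // Mc.1.
apply: (ler_gt0_addeps CV0) => d d0.
pose K := (1 + d^-1) * (k%:R * (n%:R * L ^+ 2)).
have K0 : 0 <= K.
  by rewrite !mulr_ge0 ?exprn_ge0 // addr_ge0 // invr_ge0 ltW.
apply: (ler_gt0_addeps K0) => e0 e0_gt0; pose e := Num.min e0 1.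
have e_gt0 : 0 < e by rewrite lt_min e0_gt0 /=.
have ee : e ^+ 2 <= e0.
  apply: (@le_trans _ _ e); last by rewrite ge_min lexx.
  by rewrite expr2 ler_piMr ?ge_min ?lexx ?orbT // ltW.
pose T := ('I_k * 'I_k * 'I_n * 'I_n)%type.
have /fin_all_exists[f Hf] (t : T) : exists N0, forall N, (N0 <= N)%N ->
  (0 < N)%N /\
    cabs (cycle_rep (M t.1.1.1 t.1.1.2) z t.1.2 t.2
      - compression (M t.1.1.1 t.1.1.2) N (cdval z) t.1.2 t.2) <= e.
  exact: cycle_rep_cvg.
pose N := (\max_t f t).+1.
have cN s t (i j : 'I_n) : cabs (cycle_rep (M s t) z i j
    - compression (M s t) N (cdval z) i j) <= e.
  have [//|_ h] := Hf (s, t, i, j) N; last exact: h.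
  by rewrite /N; apply: leqW; exact: (leq_bigmax (F := f)).
have := compression_contractive (cdval z) v lM Mc (ltn0Sn _ : (0 < N)%N).
rewrite -/V => h.
apply: (@le_trans _ _ ((1 + d) * (c ^+ 2 * V) + K * e ^+ 2)); last first.
  rewrite mulrDl mul1r -!addrA [c ^+ 2 * V * d]mulrC !lerD2l.
  exact: ler_wpM2l.
apply: (@le_trans _ _ (\sum_(s < k) \sum_(i < n)
  ((1 + d) * sqmod (\sum_(t < k) \sum_(j < n) compression (M s t) N (cdval z) i
    j * v t j)
   + (1 + d^-1) * (e * L) ^+ 2))).
  apply: ler_sum => s _; apply: ler_sum => i _.
  set x := \sum_(t < k) _; set y := \sum_(t < k) _.
  rewrite -[x](subrK y) addrC; apply: le_trans (sqmodD_wt _ _ d0) _.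
  rewrite lerD2l; apply: ler_wpM2l; first by rewrite addr_ge0 // invr_ge0 ltW.
  rewrite -sqr_cabs; apply: lerXn2r; rewrite ?nnegrE ?cabs_ge0 //.
    by rewrite mulr_ge0 // ltW.
  rewrite /x /y -sumrB /L mulr_sumr; apply: le_trans (ler_cabs_sum _ _ _) _.
  apply: ler_sum => t _; rewrite -sumrB mulr_sumr.
  apply: le_trans (ler_cabs_sum _ _ _) _; apply: ler_sum => j _.
  by rewrite -mulrBl cabsM; apply: ler_wpM2r; [exact: cabs_ge0|exact: cN].
under eq_bigr do rewrite big_split /= -mulr_sumr sumr_const card_ord.
rewrite big_split /= -mulr_sumr sumr_const card_ord; apply: lerD.
  by apply: ler_wpM2l => //; rewrite addr_ge0 // ltW.
have KE (a b l p q : R) :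
  a * (b * l) ^+ 2 * p * q = a * (q * (p * l ^+ 2)) * b ^+ 2 by ring.
by rewrite -[_ *+ n]mulr_natr -[_ *+ k]mulr_natr KE.
Qed.

Lemma cycle_rep_is_hom : @is_hom R (toeplitz R Q) (cycle_alg R n) cycle_rep.
Proof.
split=> [A /toeplitz_approximable FA|a A B FA FB|A B FA FB].
- exact: cycle_rep_dom.
- apply/funext => z; apply: cycle_rep_comb; exact: toeplitz_approximable.
- apply/funext => z; apply: cycle_rep_comp; exact: toeplitz_approximable.
Qed.

Lemma cycle_rep_cc : @cc_rep R (toeplitz R Q) (cycle_alg R n) cycle_rep.
Proof.
split=> [|k M MT]; first exact: cycle_rep_is_hom.
have FM s t : approximable (M s t) by apply: toeplitz_approximable; exact: MT.
have lM s t : linear (M s t) by have [] := FM s t.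
rewrite /oa_norm /=; have := mxopnorm_ge0 M (ell2_norm0 R (gpath Q)).
case ME : (mxopnorm _ M) => [c| |] //; last by move=> _; rewrite leey.
rewrite lee_fin => c0.
have Mc : mx_bounded_by M c by apply: mxopnorm_mx_bounded_by => //; rewrite ME.
apply: ge_ereal_sup => _ [z _ <-]; apply: ge_ereal_sup => _ [x /= x1 <-].
rewrite lee_fin -(@ler_pXn2r _ 2) ?nnegrE ?sqrtr_ge0 // sqr_sqrtr; last first.
  by apply: sumr_ge0 => s _; exact: sqr_ge0.
have := cycle_rep_contractive z (fun t (j : 'I_n) => x t j 0) FM Mc.
have x1' : \sum_(t < k) \sum_(j < n) sqmod (x t j 0) <= 1.
  by under eq_bigr do rewrite -cv_norm_sqr.
move=> h; have h2 := ler_piMr (exprn_ge0 2 c0) x1'.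
apply: le_trans h2; apply: le_trans h.
rewrite le_eqVlt; apply/orP; left; apply/eqP; apply: eq_bigr => s _.
rewrite cv_norm_sqr; apply: eq_bigr => i _; congr sqmod.
by rewrite summxE; apply: eq_bigr => t _; rewrite !mxE.
Qed.

End PeriodicPath.

(** * Automorphisms of the cycle algebra *)

Section Rotation.
Variables (R : realType) (n : nat).
Implicit Types (z : cdisk R) (F : cdisk R -> 'M[R[i]]_n) (a b : R[i]).

Lemma rot_proof a (ha : cabs a = 1) z : `|a * cdval z| <= 1.
Proof. by rewrite cabs_le1 cabsM ha mul1r -cabs_le1; exact: cdvalP. Qed.

Definition rot a (ha : cabs a = 1) z : cdisk R := CDisk (rot_proof ha z).

Lemma cdisk_inj z z' : cdval z = cdval z' -> z = z'.
Proof.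
case: z z' => [x hx] [y hy] /= xy; case: _ / xy hy => hy.
by congr CDisk; exact: bool_irrelevance.
Qed.

Definition pow_diag a : 'M[R[i]]_n := diag_mx (\row_i a ^+ i).

(** Conjugation by D = diag(a^i) multiplies the entry (i,j) by a^(i-j) while
    z |-> a z multiplies it by a^(j-i), up to powers of a^n: on generators
    everything cancels except at the edge from n to 1, which acquires a^n. *)
Definition rotate a (ha : cabs a = 1) F : cdisk R -> 'M[R[i]]_n :=
  fun z => pow_diag a *m F (rot ha z) *m pow_diag a^-1.

Lemma rotateE a (ha : cabs a = 1) F z i j :
  rotate ha F z i j = a ^+ i * F (rot ha z) i j * a^-1 ^+ j.
Proof. by rewrite /rotate mul_mx_diag mul_diag_mx !mxE. Qed.

Lemma unimodular_neq0 a : cabs a = 1 -> a != 0.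
Proof. by apply: contra_eq_neq => ->; rewrite cabs0 eq_sym oner_eq0. Qed.

Lemma pow_diagV a : cabs a = 1 -> pow_diag a^-1 *m pow_diag a = 1%:M.
Proof.
move=> /unimodular_neq0 a0; apply/matrixP => i j; rewrite mul_diag_mx !mxE.
case: eqP => [->|]; last by rewrite mulr0.
by rewrite mulr1n -exprMn mulVf // expr1n.
Qed.

Lemma cabsV1 a : cabs a = 1 -> cabs a^-1 = 1.
Proof. by move=> a1; rewrite cabsV a1 invr1. Qed.

Lemma rotateK a (ha : cabs a = 1) (hb : cabs a^-1 = 1) :
  cancel (rotate ha) (rotate hb).
Proof.
move=> F; apply/funext => z; apply/matrixP => i j; rewrite !rotateE invrK.
have -> : rot ha (rot hb z) = z.
  by apply: cdisk_inj; rewrite /= mulrA divff ?mul1r // unimodular_neq0.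
rewrite !mulrA -exprMn mulVf ?unimodular_neq0 // expr1n mul1r -mulrA -exprMn.
by rewrite mulVf ?unimodular_neq0 // expr1n mulr1.
Qed.

Lemma rotate_dom a (ha : cabs a = 1) F : cycle_dom F -> cycle_dom (rotate ha F).
Proof.
move=> FD i j; have [f fA FE] := FD i j.
exists (fun x : R[i]^o => (a ^+ i * a ^+ cycle_exp i j * a^-1 ^+ j) * f (a ^+ n
  * x)).
  by apply: disk_algebra_rotate => //; rewrite cabsX ha expr1n.
by move=> z; rewrite rotateE FE /= !exprMn; ring.
Qed.

Lemma rotate_is_hom a (ha : cabs a = 1) :
  @is_hom R (cycle_alg R n) (cycle_alg R n) (rotate ha).
Proof.
split=> [F|c F G _ _|F G _ _]; first exact: rotate_dom.
- apply/funext => z; change (rotate ha (c *: F + G) z =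
    c *: rotate ha F z + rotate ha G z).
  by rewrite /rotate mulmxDr mulmxDl -scalemxAr -scalemxAl.
- apply/funext => z; change (rotate ha (fun z =>
    F z *m G z) z = rotate ha F z *m rotate ha G z).
  by rewrite /rotate !mulmxA -[_ *m pow_diag a^-1 *m pow_diag a]mulmxA
    pow_diagV // mulmx1.
Qed.

Lemma cv_norm_pow_diag a (x : 'cV[R[i]]_n) : cabs a = 1 ->
  cv_norm (pow_diag a *m x) = cv_norm x.
Proof.
move=> ha; rewrite /cv_norm; congr Num.sqrt; apply: eq_bigr => i _.
by rewrite mul_diag_mx !mxE sqmodM -sqr_cabs cabsX ha !expr1n mul1r.
Qed.

Lemma rotate_norm_le a (ha : cabs a = 1) k (M : 'M[cdisk R -> 'M[R[i]]_n]_k) :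
  (cycle_norm (map_mx (rotate ha) M) <= cycle_norm M)%E.
Proof.
apply: ge_ereal_sup => _ [z _ <-].
apply: (@le_trans _ _ (Mn_norm (map_mx (fun F => F (rot ha z)) M))); last first.
  by apply: ereal_sup_ubound; exists (rot ha z).
apply: ge_ereal_sup => _ [x /= x1 <-].
apply: ereal_sup_ubound; exists (fun t => pow_diag a^-1 *m x t) => /=.
  by under eq_bigr do rewrite cv_norm_pow_diag ?cabsV1 //.
congr ((Num.sqrt _)%:E); apply: eq_bigr => s _; congr (_ ^+ 2).
rewrite -(@cv_norm_pow_diag a) // mulmx_sumr; congr cv_norm.
by apply: eq_bigr => t _; rewrite !mxE /rotate !mulmxA.
Qed.

Lemma rotate_automorphism a (ha : cabs a = 1) :
  @oa_automorphism R (cycle_alg R n) (rotate ha).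
Proof.
have hb := cabsV1 ha; have aV : a^-1^-1 = a by rewrite invrK.
have K' F : rotate ha (rotate hb F) = F.
  apply/funext => z; apply/matrixP => i j; rewrite !rotateE aV.
  have -> : rot hb (rot ha z) = z.
    by apply: cdisk_inj; rewrite /= mulrA mulVf ?mul1r // unimodular_neq0.
  rewrite !mulrA -exprMn mulfV ?unimodular_neq0 // expr1n mul1r -mulrA -exprMn.
  by rewrite mulfV ?unimodular_neq0 // expr1n mulr1.
split; first exact: rotate_is_hom.
- split.
  + exact: rotate_dom.
  + by move=> F G _ _ /(congr1 (rotate hb)); rewrite !rotateK.
  + by move=> F FD; exists (rotate hb F) => //; exact: rotate_dom.
- move=> k M _; apply/eqP; rewrite eq_le; apply/andP; split.
    exact: rotate_norm_le.
  have {1}-> : M = map_mx (rotate hb) (map_mx (rotate ha) M).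
    by apply/matrixP => s t; rewrite !mxE rotateK.
  exact: rotate_norm_le.
Qed.

Lemma pow_diag_delta a (i j : 'I_n) :
  pow_diag a *m delta_mx i j *m pow_diag a^-1 =
    (a ^+ i * a^-1 ^+ j) *: delta_mx i j.
Proof.
apply/matrixP => s t; rewrite mul_mx_diag mul_diag_mx !mxE.
case: eqP => [->|]; case: eqP => [->|]; rewrite ?(mulr0, mul0r) //=.
by rewrite !mulr1.
Qed.

Lemma rotate_pi_mu a (ha : cabs a = 1) : is_pi_mu (a ^+ n) (rotate ha).
Proof.
have a0 := unimodular_neq0 ha.
split; first exact: rotate_automorphism.
- move=> i; apply/funext => z; rewrite /rotate pow_diag_delta -exprMn.
  by rewrite divff // expr1n scale1r.
- move=> i; apply/funext => z; rewrite /rotate /Zgen -scalemxAr -scalemxAl.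
  rewrite pow_diag_delta scalerA /=.
  case: eqP => [iN|/eqP iN].
    change (a * cdval z * (a ^+ i * a^-1 ^+ (i.+1 %% n)) *: delta_mx i (ordS i)
      = a ^+ n *: (cdval z *: delta_mx i (ordS i))).
    rewrite scalerA iN modnn expr0 mulr1; congr (_ *: _).
    by rewrite -[in RHS]iN exprS mulrAC.
  have lt : (i.+1 < n)%N by rewrite ltn_neqAle iN ltn_ord.
  rewrite modn_small //; congr (_ *: _).
  by rewrite mulrAC mulrA -exprS -exprMn divff // expr1n mul1r.
Qed.

Lemma exists_pi_mu (mu : R[i]) : (0 < n)%N -> `|mu| = 1 ->
  exists q, @is_pi_mu R n mu q.
Proof.
move=> n0; rewrite cabsE => /complexI mu1; pose a : R[i] := n.-root mu.
have an : a ^+ n = mu by rewrite rootCK.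
have ha : cabs a = 1.
  apply/eqP; rewrite -(@pexpr_eq1 _ _ n) ?cabs_ge0 //.
  by rewrite -cabsX an mu1.
by exists (rotate ha); rewrite -an; exact: rotate_pi_mu.
Qed.

End Rotation.

(** * Homomorphisms out of the path algebra *)

Section Homomorphisms.
Variable R : realType.

Lemma cc_rep_comp (A B C : opalg R) (f : oa_car A -> oa_car B)
    (g : oa_car B -> oa_car C) :
  cc_rep f -> cc_rep g -> cc_rep (fun a => g (f a)).
Proof.
move=> [[fD fL fM] fN] [[gD gL gM] gN]; split.
  split=> [a Aa|c a b Aa Ab|a b Aa Ab]; first by apply: gD; exact: fD.
  - by rewrite fL // gL //; exact: fD.
  - by rewrite fM // gM //; exact: fD.
move=> k M MA; apply: le_trans (fN k M MA).
rewrite (_ : map_mx _ M = map_mx g (map_mx f M)); last first.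
  by apply/matrixP => s t; rewrite !mxE.
by apply: gN => s t; rewrite mxE; apply: fD; exact: MA.
Qed.

Lemma cc_rep_bounded (A B : opalg R) (f : oa_car A -> oa_car B) :
  cc_rep f -> bounded_hom f.
Proof.
move=> [fH fN]; split=> //; exists 1 => a Aa; rewrite mul1e.
have := fN 1%N (const_mx a); rewrite map_const_mx; apply.
by move=> s t; rewrite mxE.
Qed.

Lemma cc_rep_eq (A B : opalg R) (f g : oa_car A -> oa_car B) :
  is_hom g -> (forall a, oa_dom A a -> g a = f a) -> cc_rep f -> cc_rep g.
Proof.
move=> gH gf [_ fN]; split=> // k M MA; rewrite (_ : map_mx g M = map_mx f M).
  exact: fN.
by apply/matrixP => s t; rewrite !mxE gf.
Qed.

Lemma tau_cc n (lam : cdisk R) : @cc_rep R (cycle_alg R n) (Mn R n) (tau lam).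
Proof.
split=> [|k M _]; first by split.
by apply: ereal_sup_ubound; exists lam.
Qed.

Lemma automorphism_cc (A : opalg R) (f : oa_car A -> oa_car A) :
  oa_automorphism f -> cc_rep f.
Proof. by move=> [fH _ fN]; split=> // k M /fN ->. Qed.

(** Evaluate the matrix at a basis vector. *)
Lemma Mn_norm_entry n (a : 'M[R[i]]_n) (i j : 'I_n) :
  ((cabs (a i j))%:E <= Mn_norm (const_mx a : 'M['M[R[i]]_n]_1))%E.
Proof.
apply: (@le_trans _ _ (cv_norm (a *m delta_mx j 0))%:E); last first.
  apply: ereal_sup_ubound; exists (fun=> delta_mx j 0) => /=.
    rewrite big_ord1 sqr_sqrtr; last by apply: sumr_ge0 => l _;
      exact: sqmod_ge0.
    rewrite (bigD1 j) //= big1 => [|l /negbTE lj];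
      last by rewrite mxE lj sqmod0.
    by rewrite mxE !eqxx addr0 /sqmod /= expr1n expr0n addr0.
  by rewrite !big_ord1 !mxE sqrtr_sqr ger0_norm // sqrtr_ge0.
rewrite lee_fin /cabs /cv_norm ler_sqrt; last first.
  by apply: sumr_ge0 => l _; exact: sqmod_ge0.
rewrite (bigD1 i) //= -colE mxE lerDl.
by apply: sumr_ge0 => l _; exact: sqmod_ge0.
Qed.

Variable Q : digraph.
Local Notation H := (ell2 R (gpath Q)).

Lemma bounded_ops_subalg (I : choiceType) :
  is_closed_subalg (@ell2_norm R I) (bounded_ops (@ell2_norm R I)).
Proof.
have zeroP : bounded_by (0 : ell2 R I -> ell2 R I) 0.
  split=> // x; change (sqnorm (0 : ell2 R I) <= 0 ^+ 2 * sqnorm x).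
  by rewrite -(scale0r x); apply: le_trans (sqnormZ_le _ _) _;
    rewrite sqmod0 expr0n.
split.
- exact: subset_refl.
- apply/bounded_opsP; split; last by exists 0.
  by move=> a x y; rewrite scaler0 addr0.
- move=> a A B /bounded_opsP[lA [c Ac]] /bounded_opsP[lB [d Bd]].
  apply/bounded_opsP; split; first exact: linear_comb.
  by exists (2 * (cabs a * c + d)); apply: bounded_byD => //;
    exact: bounded_byZ.
- move=> A B /bounded_opsP[lA [c Ac]] /bounded_opsP[lB [d Bd]].
  apply/bounded_opsP; split; first exact: linear_comp.
  by exists (c * d); exact: bounded_by_comp.
- by move=> A bA _.
Qed.

Lemma toeplitz_subalg :
  is_closed_subalg (@ell2_norm R (gpath Q)) (oa_dom (toeplitz R Q)).
Proof.
have gen_bounded : @toeplitz_gen R Q `<=` bounded_ops (@ell2_norm R (gpath Q)).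
  move=> _ [[v _ <-]|[e _ <-]]; apply/bounded_opsP.
    by split; [exact: linear_pull|exists 1; exact: bounded_by_pull].
  by split; [exact: linear_pull|exists 1; exact: bounded_by_pull].
split.
- by move=> A; apply; split; [exact: bounded_ops_subalg|].
- by move=> S [[_ S0 _ _ _] _].
- by move=> c A B DA DB S [CS GS]; have [_ _ h _ _] := CS; apply: h;
    [exact: DA|exact: DB].
- by move=> A B DA DB S [CS GS]; have [_ _ _ h _] := CS; apply: h;
    [exact: DA|exact: DB].
- move=> A bA DA S [CS GS]; have [_ _ _ _ h] := CS; apply: h => // e e0.
  by have [B DB AB] := DA e e0; exists B => //; exact: DB.
Qed.

Lemma toeplitz_Pop v : oa_dom (toeplitz R Q) (Pop v).
Proof. by move=> S [_]; apply; left; exists v. Qed.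

Lemma toeplitz_Lop e : oa_dom (toeplitz R Q) (Lop e).
Proof. by move=> S [_]; apply; right; exists e. Qed.

Lemma bounded_hom_entry n (f : (H -> H) -> 'M[R[i]]_n) :
  @bounded_hom R (toeplitz R Q) (Mn R n) f -> exists2 C : R, 0 <= C &
  forall A e (i j : 'I_n), oa_dom (toeplitz R Q) A ->
    (opnorm (@ell2_norm R (gpath Q)) A < e%:E)%E -> cabs (f A i j) <= C * e.
Proof.
move=> [_ [C fC]]; exists (Num.max C 0) => [|A e i j DA Ae].
  by rewrite le_max lexx orbT.
rewrite -lee_fin; apply: le_trans (Mn_norm_entry _ _ _) _.
apply: le_trans (fC A DA) _.
have A0 : (0 <= opnorm (@ell2_norm R (gpath Q)) A)%E.
  exact: mxopnorm_ge0 (ell2_norm0 R (gpath Q)).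
apply: (@le_trans _ _ ((Num.max C 0)%:E * opnorm (@ell2_norm R (gpath Q)) A)%E).
  by apply: lee_wpmul2r => //; rewrite lee_fin le_max lexx.
rewrite EFinM; apply: lee_wpmul2l; last exact: ltW.
by rewrite lee_fin le_max lexx orbT.
Qed.

(** The elements on which f and g agree form a closed subalgebra: bounded
    homomorphisms have bounded matrix entries, so agreement passes to norm
    limits. *)
Lemma bounded_hom_unique n (f g : (H -> H) -> 'M[R[i]]_n) :
  @bounded_hom R (toeplitz R Q) (Mn R n) f ->
  @bounded_hom R (toeplitz R Q) (Mn R n) g ->
  (forall v, f (Pop v) = g (Pop v)) -> (forall e, f (Lop e) = g (Lop e)) ->
  forall A, oa_dom (toeplitz R Q) A -> f A = g A.
Proof.
move=> bf bg fgP fgL.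
have [Cf Cf0 Hf] := bounded_hom_entry bf;
  have [Cg Cg0 Hg] := bounded_hom_entry bg.
have [[_ fL fM] _] := bf; have [[_ gL gM] _] := bg.
have [T1 T2 T3 T4 T5] := toeplitz_subalg.
pose S := [set A | oa_dom (toeplitz R Q) A /\ f A = g A].
suff : oa_dom (toeplitz R Q) `<=` S by move=> sub A /sub[].
move=> A; apply; split; last first.
  move=> _ [[v _ <-]|[e _ <-]]; split; rewrite ?fgP ?fgL //.
    exact: toeplitz_Pop.
  exact: toeplitz_Lop.
split.
- by move=> B [/T1].
- split=> //; have f0 := fL (-1) 0 0 T2 T2; have g0 := gL (-1) 0 0 T2 T2.
  rewrite scaler0 addr0 !scaleN1r !addNr in f0 g0; by rewrite f0 g0.
- move=> c B D [DB fB] [DD fD]; split; first exact: T3.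
  by rewrite fL // gL // fB fD.
- move=> B D [DB fB] [DD fD]; split; first exact: T4.
  by have := fM B D DB DD; have := gM B D DB DD; rewrite /= fB fD => -> ->.
- move=> B bB HB.
  have DB : oa_dom (toeplitz R Q) B.
    by apply: T5 => // e e0; have [D [DD _] BD] := HB e e0; exists D.
  split=> //; apply/matrixP => i j.
  apply: (@complex_eq_small _ _ _ (Cf + Cg)) => [|e e0 _];
    first exact: addr_ge0.
  have [D [DD fD] BD] := HB e e0.
  have DBD : oa_dom (toeplitz R Q) (B - D) by rewrite addrC -scaleN1r;
    exact: T3.
  have h1 := Hf _ _ i j DBD BD; have h2 := Hg _ _ i j DBD BD.
  have fBD : f (B - D) = f B - f D by rewrite addrC -scaleN1r fL // scaleN1r
    addrC.
  have gBD : g (B - D) = g B - g D by rewrite addrC -scaleN1r gL // scaleN1r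
    addrC.
  have -> : f B i j - g B i j = f (B - D) i j - g (B - D) i j.
    by rewrite fBD gBD fD !mxE; ring.
  apply: le_trans (ler_cabsB _ _) _; lra.
Qed.

End Homomorphisms.

(** * Closed paths *)

Section ClosedPath.
Variables (R : realType) (Q : digraph) (w : gpath Q).
Hypothesis w_gt0 : (0 < plen w)%N.

Definition cyc_edge k : edge Q :=
  tnth (in_tuple (pedges w)) (Ordinal (ltn_pmod k w_gt0)).

Lemma cyc_edge_periodic k : cyc_edge (k + plen w) = cyc_edge k.
Proof. by congr tnth; apply: val_inj; rewrite /= modnDr. Qed.

Lemma cyc_edge_pedge (j : 'I_(plen w)) : cyc_edge j = pedge j.
Proof. by congr tnth; apply: val_inj; rewrite /= modn_small. Qed.

Lemma is_path_nth (es : seq (edge Q)) v e0 k : is_path es v ->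
  (k < size es)%N ->
  src (nth e0 es k) =
  if (k.+1 < size es)%N then rng (nth e0 es k.+1) else v.
Proof.
elim: es k => [|e es IH] [|k] //= /andP[/eqP ev pes] ks; last exact: IH.
by rewrite -ev; case: es {IH ev ks} pes => //=.
Qed.

Lemma cyc_edge_path : prng w = psrc w ->
  forall k, rng (cyc_edge k.+1) = src (cyc_edge k).
Proof.
move=> closed k; pose e0 := cyc_edge 0.
have km : (k %% plen w < plen w)%N by rewrite ltn_mod.
rewrite /cyc_edge !(tnth_nth e0) /= (is_path_nth e0 (pvalP w)) //.
rewrite -addn1 -modnDml addn1; case: ifPn => [lt|].
  by rewrite modn_small.
rewrite -leqNgt => ge; have -> : (k %% plen w).+1 = plen w.
  by apply/eqP; rewrite eqn_leq km.
rewrite modnn -[RHS]closed /prng /pre_rng; move: w_gt0.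
by rewrite /plen; case: (pedges w).
Qed.

(** For the first edge e of w, compare at z = 1 the entries in row n and
    column 1 of the images of L_e and of P_(r(e)) L_e. The former is 1; the
    latter vanishes unless the last edge of w starts at r(e). *)
Lemma iota_w_closed iota : @is_iota_w R Q w iota -> prng w = psrc w.
Proof.
move=> [[[_ _ iM] _] iP iL].
pose j0 := Ordinal w_gt0; pose e := pedge j0; pose l := ord_pred j0.
have src_l : src (pedge l) = psrc w.
  rewrite /pedge (tnth_nth e) /= (is_path_nth e (pvalP w)) /=; last first.
    exact: ltn_ord l.
  have -> : ((0 + plen w).-1 %% plen w = (plen w).-1)%N.
    by rewrite add0n modn_small // prednK.
  by rewrite prednK // ltnn.
have rng_e : rng e = prng w.
  rewrite /e /pedge (tnth_nth e) /= /prng /pre_rng; move: w_gt0.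
  by rewrite /plen; case: (pedges w).
have LE : Lop (R := R) e = Pop (rng e) \o Lop e.
  apply/funext => x; apply: ell2P => u.
  have -> : (Pop (rng e) \o Lop e) x u =
    if prng u == rng e then Lop e x u else 0.
    by rewrite /= /pull_fun /Pmap; case: ifP.
  case: eqP => // ne; rewrite /= /pull_fun /Lmap; move: ne;
    rewrite /prng /pre_rng.
  by case: (pedges u) => [|e' es] //= ne; case: eqP => // ee; case: ne;
    rewrite ee.
have one_disk : `|1 : R[i]| <= 1 by rewrite normr1.
pose z := CDisk one_disk.
have := iM (Pop (rng e)) (Lop e) (@toeplitz_Pop _ _ _) (@toeplitz_Lop _ _ _).
rewrite /= -LE => /(congr1 (fun F : cdisk R -> 'M[R[i]]_(plen w) => F z l j0)).
rewrite iP iL fct_sumE summxE (bigD1 j0) //= big1 => [|j /andP[_ /negbTE jj]];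
  last first.
  by rewrite /Zgen !mxE ord_predK [j0 == j]eq_sym jj andbF mulr0.
rewrite /Zgen !mxE ord_predK !eqxx mulr1 addr0.
case: (eqVneq (src (pedge l)) (rng e)) => [se _|ne].
  by rewrite -rng_e -se src_l.
rewrite big1 => [/eqP|m _]; first by rewrite oner_eq0.
rewrite summxE big1 ?mul0r // => j /eqP jv; rewrite mxE.
by case: (l =P j) => // lj; rewrite -lj in jv; rewrite jv eqxx in ne.
Qed.

End ClosedPath.

(** * Generators of the cycle algebra *)

Section CycleDomain.
Variables (R : realType) (n : nat).
Hypothesis n_gt0 : (0 < n)%N.

Lemma disk_algebra_horner (p : {poly R[i]}) : @disk_algebra R (horner p).
Proof.
apply: limit_disk_algebra; exists (\sum_(i < size p) cabs p`_i).
  by apply: sumr_ge0 => i _; exact: cabs_ge0.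
move=> e e0; exists p => [d|z _]; last by rewrite subrr cabs0 ltW.
have [dp|pd] := ltnP d (size p).
  by rewrite (bigD1 (Ordinal dp)) //= lerDl; apply: sumr_ge0 => i _;
    exact: cabs_ge0.
by rewrite nth_default // cabs0; apply: sumr_ge0 => i _; exact: cabs_ge0.
Qed.

Lemma disk_algebraD (f g : R[i]^o -> R[i]^o) : disk_algebra f ->
  disk_algebra g ->
  disk_algebra (fun x => f x + g x : R[i]^o).
Proof.
move=> [/subspace_continuousP fc fd] [/subspace_continuousP gc gd]; split.
  by apply/subspace_continuousP => x x1; apply: cvgD; [exact: fc|exact: gc].
by move=> z z1; apply: derivableD; [exact: fd|exact: gd].
Qed.

Lemma cycle_domD (F G : cdisk R -> 'M[R[i]]_n) :
  cycle_dom F -> cycle_dom G -> cycle_dom (F + G).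
Proof.
move=> FD GD i j; have [f fA fE] := FD i j; have [g gA gE] := GD i j.
exists (fun x => f x + g x : R[i]^o); first exact: disk_algebraD.
by move=> z; rewrite mulrDr -fE -gE; exact: mxE.
Qed.

(** For n = 1 the exponent of a loop is 0 and not 1: its symbol z is then a
    function of z^n. *)
Lemma cycle_exp_ordS (i : 'I_n) : cycle_exp i (ordS i) = (1 %% n)%N.
Proof.
have [n1|n1] := ltnP 1 n.
  rewrite (modn_small n1); apply/esym/eqP.
  by rewrite -(cycle_expP n_gt0 i (ordS i) (Ordinal n1)) /= addn1.
have nE : n = 1%N by apply/eqP; rewrite eqn_leq n1.
have -> : (1 %% n = 0)%N by rewrite nE.
have := cycle_exp_lt n_gt0 i (ordS i); move: (cycle_exp _ _) => k; lia.
Qed.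

Lemma cycle_dom_delta (i : 'I_n) : @cycle_dom R n (fun=> delta_mx i i).
Proof.
move=> a b; exists (horner ((a == i) && (b == i))%:R%:P).
  exact: disk_algebra_horner.
move=> z; rewrite hornerC mxE; case: (a =P i) => [->|]; rewrite ?mulr0 //=.
case: (b =P i) => [->|]; rewrite ?mulr0 //.
by rewrite /cycle_exp addnC addnK modnn expr0 mulr1.
Qed.

Lemma cycle_dom_Zgen (i : 'I_n) : @cycle_dom R n (Zgen i).
Proof.
move=> a b.
exists (horner (((a == i) && (b == ordS i))%:R *: 'X^(1 %/ n))).
  exact: disk_algebra_horner.
move=> z; rewrite hornerZ hornerXn /Zgen !mxE.
case: (a =P i) => [->|]; rewrite ?(mulr0, mul0r) //=.
case: (b =P ordS i) => [->|]; rewrite ?(mulr0, mul0r) //=.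
by rewrite mul1r mulr1 cycle_exp_ordS -exprM -exprD addnC [(n * _)%N]mulnC
  -divn_eq expr1.
Qed.

Lemma cycle_hom_sum (q : oa_car (cycle_alg R n) -> oa_car (cycle_alg R n))
    (T : Type) (s : seq T) (P : pred T) (G : T -> cdisk R -> 'M[R[i]]_n) :
  is_hom q -> (forall t, cycle_dom (G t)) ->
  q (\sum_(t <- s | P t) G t) = \sum_(t <- s | P t) q (G t).
Proof.
move=> [qD qL _] GD.
have D0 : @cycle_dom R n 0.
  move=> i j; exists (horner 0); first exact: disk_algebra_horner.
  by move=> z; rewrite horner0 mulr0; exact: mxE.
suff [] : cycle_dom (\sum_(t <- s | P t) G t) /\
  q (\sum_(t <- s | P t) G t) = \sum_(t <- s | P t) q (G t) by [].
elim/big_rec2: _ => [|t y x _ [xD xy]]; split=> //.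
- by have := qL (-1) 0 0 D0 D0; rewrite scaler0 addr0 scaleN1r addNr.
- exact: cycle_domD.
- by have := qL 1 (G t) x (GD t) xD; rewrite !scale1r xy.
Qed.

End CycleDomain.

(** * The factorization *)

Section Factorization.
Variables (R : realType) (Q : digraph) (w : gpath Q).
Hypothesis w_gt0 : (0 < plen w)%N.

Lemma exists_iota_w : prng w = psrc w ->
  exists2 iota, @is_iota_w R Q w iota & @cc_rep R (toeplitz R Q) (cycle_alg R
    (plen w)) iota.
Proof.
move=> cl; have EP := cyc_edge_path w_gt0 cl.
have cc := cycle_rep_cc R w_gt0 (cyc_edge_periodic w_gt0) EP.
exists (cycle_rep (plen w) EP) => //; split; first exact: cc_rep_bounded.
- move=> v; apply: etrans (cycle_rep_Pop _ w_gt0 (cyc_edge_periodic w_gt0) EP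
    v) _.
  apply/funext => z; apply: eq_bigl => j; by rewrite cyc_edge_pedge.
- move=> e; apply: etrans (cycle_rep_Lop _ w_gt0 (cyc_edge_periodic w_gt0) EP
    e) _.
  by apply: eq_bigl => j; rewrite cyc_edge_pedge.
Qed.

(** Evaluation at each point of the disk reduces uniqueness of iota_w to
    homomorphisms into matrices. *)
Lemma iota_w_cc iota : @is_iota_w R Q w iota ->
  @cc_rep R (toeplitz R Q) (cycle_alg R (plen w)) iota.
Proof.
move=> iw; have [iota' iw' cc'] := exists_iota_w (iota_w_closed w_gt0 iw).
have [bi iP iL] := iw; have [bi' iP' iL'] := iw'.
apply: cc_rep_eq cc'; first by have [] := bi.
move=> A DA; apply/funext => z.
have tau_bounded f : @bounded_hom R (toeplitz R Q) (cycle_alg R (plen w)) f ->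
    @bounded_hom R (toeplitz R Q) (Mn R (plen w)) (fun A => f A z).
  move=> [[fD fL fM] [C fC]]; split.
    split=> // [c a b Da Db|a b Da Db]; first by rewrite fL.
    by rewrite fM.
  exists C => a Da; apply: le_trans (fC a Da).
  by apply: ereal_sup_ubound; exists z; [exact: I|rewrite map_const_mx].
apply: (bounded_hom_unique (tau_bounded _ bi) (tau_bounded _ bi')) => //.
- by move=> v; rewrite iP iP'.
- by move=> e; rewrite iL iL'.
Qed.

Variables (lam : cdisk R) (mu : R[i]).

Lemma is_pi_w_comp iota q : @is_iota_w R Q w iota ->
  @is_pi_mu R (plen w) mu q ->
  @is_pi_w R Q w lam mu (fun A => tau lam (q (iota A))) /\
  @cc_rep R (toeplitz R Q) (Mn R (plen w)) (fun A => tau lam (q (iota A))).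
Proof.
move=> iw qm; have icc := iota_w_cc iw; have [_ iP iL] := iw.
have [qa qP qZ] := qm; have qcc := automorphism_cc qa.
have [qD qL qM] := qcc.1.
have cc := cc_rep_comp icc (cc_rep_comp qcc (tau_cc (plen w) lam)).
split=> //; split; first exact: cc_rep_bounded.
- move=> v; rewrite iP /tau.
  have -> : (fun=> \sum_(j < plen w | src (pedge j) == v) delta_mx j j) =
      \sum_(j < plen w | src (pedge j) == v)
        (fun _ : cdisk R => delta_mx j j : 'M[R[i]]_(plen w)).
    by apply/funext => z; rewrite fct_sumE.
  rewrite (cycle_hom_sum _ _ qcc.1); last exact: cycle_dom_delta.
  by rewrite fct_sumE; apply: eq_bigr => j _; rewrite qP.
- move=> e; rewrite iL /tau (cycle_hom_sum _ _ qcc.1); last by move=> j;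
    exact: (cycle_dom_Zgen R w_gt0).
  rewrite fct_sumE; apply: eq_bigr => j _; rewrite qZ.
  have -> : ((ord_pred j).+1 == plen w) = (j == 0%N :> nat).
    rewrite /=; case: (nat_of_ord j) (ltn_ord j) => [|k] kw.
      by rewrite add0n modn_small ?prednK ?eqxx.
    by rewrite addSn /= modnDr modn_small ?(ltnW kw) // ltn_eqF.
  case: ifP => _; last by rewrite mulr1 /Zgen ord_predK.
  by rewrite mulrC -scalerA -[X in delta_mx _ X]ord_predK.
Qed.

End Factorization.

Theorem theorem3p5 (R : realType) (Q : digraph) (lam : cdisk R) (mu : R[i])
    (hmu : `|mu| = 1) (w : gpath Q) (hw : (0 < plen w)%N) :
  [/\ prng w = psrc w ->
        (exists iota, @is_iota_w R Q w iota) /\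
        (exists p, @is_pi_w R Q w lam mu p),
      exists q, @is_pi_mu R (plen w) mu q &
      forall p iota q,
        @is_pi_w R Q w lam mu p ->
        @is_iota_w R Q w iota ->
        @is_pi_mu R (plen w) mu q ->
        @factors_via R (toeplitz R Q) (cycle_alg R (plen w)) (Mn R (plen w))
          p iota (fun F => tau lam (q F))].
Proof.
have [q0 q0P] := exists_pi_mu hw hmu.
split=> [closed||p iota q pP iP qP]; last 2 first.
- by exists q0.
- have [[bq qPop qLop] qcc] := is_pi_w_comp hw lam iP qP.
  have [bp pPop pLop] := pP; have [qa _ _] := qP.
  have pE := bounded_hom_unique bp bq (fun v => etrans (pPop v) (esym (qPop v)))
    (fun e => etrans (pLop e) (esym (qLop e))).
  split.
  + exact: cc_rep_eq bp.1 pE qcc.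
  + exact: (iota_w_cc hw iP).
  + exact: cc_rep_comp (automorphism_cc qa) (tau_cc _ lam).
  + exact: pE.
have [iota iP _] := exists_iota_w R hw closed.
split; first by exists iota.
by exists (fun A => tau lam (q0 (iota A)));
  have [] := is_pi_w_comp hw lam iP q0P.
Qed.
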